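(* Let $d\ge 2$ and let $h:(0,\infty)\to(0,\infty)$ be a gauge function such that $h(2t)\le 2^d h(t)$ and $$\int_0^1 t^{-1}\sqrt{t^{1-d}\,|\log(t)|\,h(t)}\,dt<+\infty.$$ Then there exists a compact set $A\subset\mathbb{R}^d$ with the following properties: (1) For each $n$, $A$ can be covered by $C/h(2^{-n})$ balls of radius $2^{-n}$, where $C>0$ depends only on $d$. (2) $0<\mathcal{H}^h(A)<\infty$. (3) If $B\subset A$ is a Borel set with $\mathcal{H}^h(B)>0$, then $B$ is not tube null. In particular, $A$ is not tube null.
   Context: A gauge function is a function $h:(0,\infty)\to(0,\infty)$ that is non-decreasing, continuous and satisfies $\lim_{t\downarrow 0}h(t)=0$. The $h$-dimensional Hausdorff measure is $$\mathcal{H}^h(E)=\lim_{\delta\to 0}\inf\Big\{\sum_{i=1}^\infty h(\mathrm{diam}(E_i)) : E\subset\bigcup_i E_i,\ \mathrm{diam}(E_i)<\delta\Big\}.$$ A tube $T$ of width $w=w(T)>0$ is the $w$-neighborhood of some line in $\mathbb{R}^d$. A set $A\subset\mathbb{R}^d$ is tube null if for any $\delta>0$ it can be covered by countably many tubes $\{T_j\}$ with $\sum_j w(T_j)^{d-1}\le\delta$.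
   Formalization: In (1) the number of balls is read as at most C/h(2^{-n}) rounded up to an integer; without rounding and with C depending only on d, the claim fails for large multiples of h (if h(1) > C, then n = 0 forces A to be empty, contradicting (2)). *)

(* Defs.v *)
From HB Require Import structures.
From mathcomp Require Import all_boot all_order all_algebra.
From mathcomp Require Import all_classical all_reals all_analysis.

Set Implicit Arguments.
Unset Strict Implicit.
Unset Printing Implicit Defensive.

Import Order.TTheory GRing.Theory Num.Theory.
Import numFieldNormedType.Exports.

Local Open Scope classical_set_scope.
Local Open Scope ring_scope.

(* R^d is 'rV[R]_d. The library norm and balls on matrices come from the sup
   norm, hence the explicit Euclidean norm; the topology is the usual one. *)
Definition enorm (R : realType) (d : nat) (x : 'rV[R]_d) : R :=
  Num.sqrt (\sum_(i < d) x 0 i ^+ 2).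

Definition eball (R : realType) (d : nat) (x : 'rV[R]_d) (r : R)
  : set 'rV[R]_d := [set y | enorm (y - x) < r].

(* Extended-real valued, so that unbounded sets have diameter +oo; taking the
   maximum with 0 gives diam set0 = 0. *)
Definition diam (R : realType) (d : nat) (E : set 'rV[R]_d) : \bar R :=
  maxe 0%E
    (ereal_sup [set z | exists x y, [/\ E x, E y & z = (enorm (x - y))%:E]]).

(* Only the values of h on (0, +oo) are relevant. *)
Definition gauge_function (R : realType) (h : R -> R) : Prop :=
  [/\ forall t : R, 0 < t -> 0 < h t,
      forall s t : R, 0 < s -> s <= t -> h s <= h t,
      forall t : R, 0 < t -> {for t, continuous h}
    & h t @[t --> 0^'+] --> (0 : R)].

(* h extended by its limit h(0) = 0, as needed for sets of diameter 0. *)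
Definition gauge0 (R : realType) (h : R -> R) (t : R) : R :=
  if 0 < t then h t else 0.

Definition hausdorff_pre (R : realType) (d : nat) (h : R -> R)
    (delta : R) (E : set 'rV[R]_d) : \bar R :=
  ereal_inf [set s | exists F : nat -> set 'rV[R]_d,
    [/\ E `<=` \bigcup_i F i,
        forall i, (diam (F i) < delta%:E)%E
      & s = (\sum_(0 <= i <oo) (gauge0 h (fine (diam (F i))))%:E)%E]].

Definition hausdorff_measure (R : realType) (d : nat) (h : R -> R)
    (E : set 'rV[R]_d) : \bar R :=
  lim (hausdorff_pre h delta E @[delta --> 0^'+]).

Definition line (R : realType) (d : nat) (p v : 'rV[R]_d) : set 'rV[R]_d :=
  [set p + t *: v | t in [set: R]].

Definition is_tube (R : realType) (d : nat) (T : set 'rV[R]_d) (w : R) : Prop :=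
  0 < w /\ exists p v : 'rV[R]_d,
    v != 0 /\ T = \bigcup_(y in line p v) eball y w.

(* The index set J allows finite as well as infinite families of tubes. *)
Definition tube_null (R : realType) (d : nat) (A : set 'rV[R]_d) : Prop :=
  forall delta : R, 0 < delta ->
    exists (J : set nat) (T : nat -> set 'rV[R]_d) (w : nat -> R),
      [/\ forall j, J j -> is_tube (T j) (w j),
          A `<=` \bigcup_(j in J) T j
        & (\esum_(j in J) (w j ^+ d.-1)%:E <= delta%:E)%E].

(* A is covered by "y balls" of radius r. The real number y is rounded up:
   without rounding, y < 1 would force A to be empty, and a bound
   y = C / h (2 ^- n) with C independent of h cannot hold for the gauges
   lambda * h with lambda large. *)
Definition covered_by_balls (R : realType) (d : nat) (A : set 'rV[R]_d)
    (y r : R) : Prop :=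
  exists (N : nat) (x : 'I_N -> 'rV[R]_d),
    N%:Z <= Num.ceil y /\ A `<=` \bigcup_i eball (x i) r.

Definition borel_set (R : realType) (d : nat) (B : set 'rV[R]_d) : Prop :=
  <<s @open 'rV[R]_d >> B.

(* Main.v *)
Require Import Defs.
From mathcomp Require Import all_boot all_order all_algebra.
From mathcomp Require Import all_classical all_reals all_analysis.
From mathcomp Require Import measurable_realfun.
From mathcomp Require Import ring lra zify.

(** The set is an intersection of unions [A_n] of dyadic cubes of side [2^-n].
    At each step either all children of every cube of [A_n] are kept, or exactly
    one child of each, in such a way that the number of cubes of [A_n] is
    comparable to [1 / h(2^-n)]. If the single children are chosen at random,
    the integral along a fixed line of the normalized density of [A_n] is a
    martingale, and a Hoeffding bound over a net of [2^O(n)] lines shows that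
    some choice multiplies the supremum over all lines of these integrals by at
    most [exp(O(e_n))], where [e_n^2 = n 2^(n(d-1)) h(2^-n)]; the [e_n] are
    summable by the integral condition. Consequently a tube of width
    [w ~ 2^-n] meets [O(w^(d-1) / h(2^-n))] cubes of [A_n], and replacing the
    tubes of a covering by these cubes shows that tube null subsets of the set
    are null for the Hausdorff measure. The measure of the set itself is bounded
    below by counting cubes in a finite subcover. *)

Set Implicit Arguments.
Unset Strict Implicit.
Unset Printing Implicit Defensive.

Import Order.TTheory GRing.Theory Num.Theory.
Import numFieldNormedType.Exports.

Local Open Scope classical_set_scope.
Local Open Scope ring_scope.

(** * Choosing by conditional expectations *)

(** Up to constants, [e_n] is the geometric mean of two quantities: the logarithm of the number of
    lines in the net, of order [n], and the largest share [2^(n(d-1)) h(2^-n)] that one cube can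
    have in a line integral. The deviation bound is multiplicative and requires no smallness of
    [e_n], so the first few large [e_n] cost only a constant factor. The obstacle is that the time
    spent by a line in a cube is not continuous in the line: a line almost parallel to a face may
    jump across it under a tiny change of coefficients. The net is therefore not described by close
    coefficients alone; a nearly constant coordinate is recorded by its initial cell and by the
    moment at which it leaves that cell. As all cubes of a level have equally many children, the
    uniform distributions on the levels are compatible. Statements about a limit measure thus reduce
    to counting cubes, and no measure on the set is constructed. *)

Section Derandomization.
Variable R : realType.
Implicit Types (x t S B : R).

Lemma expR_chord x t : 0 <= x <= 1 -> expR (t * x) <= 1 + x * (expR t - 1).
Proof.
move=> /andP[x0 x1].
pose u : {i01 R} := Itv01 x0 x1.
have /= := convex_expR u t 0.
rewrite !convRE/= expR0 !mulr0 addr0 mulr1 mulrC /unstable.onem => h.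
apply: (le_trans h); lra.
Qed.

Lemma exists_le_average (E : finType) (F : E -> R) : (0 < #|E|)%N ->
  exists e, F e <= (\sum_e F e) / #|E|%:R.
Proof.
move=> E0; apply/not_existsP => H.
have q0 : 0 < #|E|%:R :> R by rewrite ltr0n.
have : (\sum_e F e) / #|E|%:R * #|E|%:R < \sum_e F e.
  rewrite [ltLHS](_ : _ = \sum_(e : E) (\sum_e F e) / #|E|%:R); last first.
    by rewrite sumr_const mulr_natr.
  have /card_gt0P[e0 _] := E0.
  rewrite (bigD1 e0)//= [ltRHS](bigD1 e0)//=; apply: ltr_leD.
    by rewrite ltNge; apply/negP/H.
  by apply: ler_sum => e _; rewrite leNgt; apply/negP => /ltW /H.
by rewrite mulfVK ?ltxx ?gt_eqF.
Qed.

(* Method of conditional expectations: the choices are fixed one index at a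
   time, never letting the averaged weighted product increase. *)
Lemma exists_choice_prod (E G : finType) (I : eqType) (A : seq I)
    (g : G -> I -> E -> R) (w : G -> R) : (0 < #|E|)%N -> uniq A ->
  exists c : I -> E,
    \sum_j w j * \prod_(k <- A) g j k (c k) <=
    \sum_j w j * \prod_(k <- A) ((\sum_e g j k e) / #|E|%:R).
Proof.
move=> E0; elim: A w => [|k A IH] w /=.
  move=> _; have /card_gt0P[e _] := E0; exists (fun=> e).
  by apply: ler_sum => j _; rewrite !big_nil.
move=> /andP[kA uA].
pose m j i := (\sum_e g j i e) / #|E|%:R.
have [e he] := exists_le_average
  (fun e => \sum_j (w j * g j k e) * \prod_(i <- A) m j i) E0.
have [c hc] := IH (fun j => w j * g j k e) uA.
exists (fun i => if i == k then e else c i).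
rewrite [leLHS](_ : _ = \sum_j w j * g j k e * \prod_(i <- A) g j i (c i)).
  apply: (le_trans hc); apply: (le_trans he).
  rewrite exchange_big/= mulr_suml; apply: ler_sum => j _.
  rewrite big_cons -mulr_suml -mulr_sumr /m.
  by rewrite [X in _ <= X](_ : _ = w j * (\sum_e g j k e) * \prod_(i <- A) m j i
    / #|E|%:R) // /m; ring.
apply: eq_bigr => j _; rewrite big_cons eqxx mulrA; congr (_ * _).
rewrite !big_seq; apply: eq_bigr => i iA; case: eqP => // ik.
by rewrite -ik iA in kA.
Qed.

(** An exponential moment bound for all [j] at once: the sum over [j] of the exponentials is kept
    below its average, and each single term is at most that sum. The result is a factor on [S], so
    that it can be iterated over levels. *)
Lemma exists_choice_le (G E : finType) (I : eqType) (A : seq I)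
    (V : G -> I -> E -> R) (B S : R) :
  (0 < #|E|)%N -> (1 < #|G|)%N -> uniq A -> 0 < B -> 1 <= S ->
  (forall j k e, 0 <= V j k e <= B) ->
  (forall j, \sum_(k <- A) (\sum_e V j k e) / #|E|%:R <= S) ->
  exists c : I -> E, forall j, \sum_(k <- A) V j k (c k) <=
    S * expR (2 * Num.sqrt (B * ln #|G|%:R)).
Proof.
move=> E0 G1 uA B0 S1 VB mS.
have q0 : 0 < #|E|%:R :> R by rewrite ltr0n.
have L0 : 0 < ln #|G|%:R :> R by rewrite ln_gt0// ltr1n.
(* With this [t] the cost [B / t * ln #|G|] of treating all [j] together equals [t] itself; then
   [t + expR t * S] is absorbed into [S * expR (2 * t)] because [1 <= S]. *)
set t := Num.sqrt _.
have t0 : 0 < t by rewrite sqrtr_gt0 mulr_gt0.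
have t2 : t ^+ 2 = B * ln #|G|%:R by rewrite sqr_sqrtr// mulr_ge0 ?ltW.
have Et1 : 1 <= expR t by rewrite -expR0 ler_expR ltW.
have [c hc] := @exists_choice_prod E G I A
  (fun j k e => expR (t * (V j k e / B))) (fun=> 1) E0 uA.
exists c => j0; set W := \sum_(k <- A) _.
have hW : expR (t * (W / B)) <= #|G|%:R * expR ((expR t - 1) * (S / B)).
  apply: (@le_trans _ _ (\sum_j 1 * \prod_(k <- A) expR (t * (V j k (c k) / B)))).
    rewrite (bigD1 j0)//= mul1r -expR_sum -mulr_sumr -mulr_suml lerDl.
    by apply: sumr_ge0 => j _; rewrite mul1r prodr_ge0// => k _; exact: expR_ge0.
  apply: (le_trans hc).
  have -> : #|G|%:R * expR ((expR t - 1) * (S / B)) =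
      \sum_(j : G) expR ((expR t - 1) * (S / B)) by rewrite sumr_const mulr_natl.
  apply: ler_sum => j _; rewrite mul1r.
  apply: (@le_trans _ _ (\prod_(k <- A)
      expR ((expR t - 1) * ((\sum_e V j k e) / #|E|%:R / B)))).
    apply: ler_prod => k _; apply/andP; split.
      by rewrite mulr_ge0 ?invr_ge0 ?ler0n// sumr_ge0// => e _; exact: expR_ge0.
    apply: le_trans (expR_ge1Dx _).
    rewrite ler_pdivrMr//.
    have -> : (1 + (expR t - 1) * ((\sum_e V j k e) / #|E|%:R / B)) * #|E|%:R
      = \sum_(e : E) (1 + V j k e / B * (expR t - 1)).
      rewrite big_split/= sumr_const -mulr_suml -mulr_suml.
      by field; rewrite !gt_eqF.
    apply: ler_sum => e _; apply: expR_chord.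
    have /andP[V0 V1] := VB j k e.
    apply/andP; split; first by rewrite divr_ge0// ltW.
    by rewrite ler_pdivrMr// mul1r.
  rewrite -expR_sum ler_expR -mulr_sumr -mulr_suml.
  by rewrite ler_wpM2l ?subr_ge0// ler_pM2r ?invr_gt0//.
have hW2 : t * (W / B) <= ln #|G|%:R + (expR t - 1) * (S / B).
  by rewrite -ler_expR expRD lnK ?posrE ?ltr0n ?(ltn_trans _ G1).
have hW3 : W * t <= t ^+ 2 + (expR t - 1) * S.
  rewrite t2; have := ler_wpM2r (ltW B0) hW2.
  rewrite mulrDl -!mulrA mulVf ?gt_eqF// !mulr1 => h; lra.
have hE : expR t - 1 <= t * expR t.
  have := expR_ge1Dx (- t); rewrite expRN => h.
  have : (1 - t) * expR t <= 1.
    by rewrite -ler_pdivlMr ?expR_gt0// mul1r.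
  lra.
have hWS : W <= t + expR t * S.
  rewrite -(ler_pM2r t0).
  have : (expR t - 1) * S <= t * expR t * S by rewrite ler_wpM2r//; lra.
  by rewrite expr2 in hW3; move: hW3; lra.
apply: (le_trans hWS).
rewrite mulrDl mul1r expRD.
have := expR_ge1Dx t => h1.
have : (1 + t) * expR t * S <= expR t * expR t * S.
  by rewrite !ler_wpM2r ?expR_ge0//; lra.
have : t * 1 <= t * (expR t * S).
  rewrite ler_wpM2l ?(ltW t0)//.
  rewrite -[leLHS]mulr1; apply: ler_pM => //.
lra.
Qed.
End Derandomization.

(** * A finite net of affine coordinate functions *)

Section Bands.
Variable R : realType.
Implicit Types (a b s : R) (m r k : nat).

(** Half-open in value, unlike the closed cubes that form the limit set: occupation times must add
    up exactly over children, whereas compactness needs closed cubes. *)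
Definition band m a b k : set R :=
  [set s | 0 <= s < 1 /\ k%:R <= 2 ^+ m * (a + b * s) < k.+1%:R].

Lemma band_convex m a b k (s t u : R) :
  band m a b k s -> band m a b k u -> s <= t <= u -> band m a b k t.
Proof.
move=> [/andP[s0 s1] /andP[ks sk]] [/andP[u0 u1] /andP[ku uk]] /andP[st tu].
split; first by apply/andP; split; lra.
have m0 : 0 < 2 ^+ m :> R by rewrite exprn_gt0.
have [b0|b0] := leP 0 b.
  have h1 : 2 ^+ m * (a + b * s) <= 2 ^+ m * (a + b * t).
    by rewrite ler_pM2l// lerD2l ler_wpM2l.
  have h2 : 2 ^+ m * (a + b * t) <= 2 ^+ m * (a + b * u).
    by rewrite ler_pM2l// lerD2l ler_wpM2l.
  by apply/andP; split; lra.
have h1 : 2 ^+ m * (a + b * t) <= 2 ^+ m * (a + b * s).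
  by rewrite ler_pM2l// lerD2l ler_wnM2l// ltW.
have h2 : 2 ^+ m * (a + b * u) <= 2 ^+ m * (a + b * t).
  by rewrite ler_pM2l// lerD2l ler_wnM2l// ltW.
by apply/andP; split; lra.
Qed.

Lemma measurable_band m a b k : measurable (band m a b k).
Proof.
apply: is_interval_measurable => s u hs hu t stu.
exact: band_convex hs hu stu.
Qed.

Lemma band_disjoint m a b k k' s : band m a b k s -> band m a b k' s -> k = k'.
Proof.
move=> [_ /andP[ks sk]] [_ /andP[ks' sk']].
have : (k < k'.+1)%N by rewrite -(ltr_nat R); apply: le_lt_trans sk'.
have : (k' < k.+1)%N by rewrite -(ltr_nat R); apply: le_lt_trans sk.
lia.
Qed.

Lemma int_itv_uniq (i j : int) (z : R) :
  i%:~R <= z < i%:~R + 1 -> j%:~R <= z < j%:~R + 1 -> i = j.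
Proof.
move=> /andP[iz zi] /andP[jz zj].
have : (i < j + 1)%R by rewrite -(ltr_int R) intrD; lra.
have : (j < i + 1)%R by rewrite -(ltr_int R) intrD; lra.
lia.
Qed.

Lemma truncn_eq_dist (x y : R) : 0 <= x -> 0 <= y ->
  Num.truncn x = Num.truncn y -> `|x - y| <= 1.
Proof.
move=> /truncn_itv/andP[x1 x2] /truncn_itv/andP[y1 y2] e.
rewrite -e -natr1 in y1 y2; rewrite -natr1 in x2.
by rewrite ler_norml; apply/andP; split; lra.
Qed.

(** At a time in the difference the value is within [e] of an endpoint of the dyadic interval, and a
    slope of at least [2^-m] confines such times to an interval of length [2 * e * 2^m] around each
    of the two crossing times. *)
Lemma big_slope_band m (e a b a' b' : R) k : 0 <= e -> 2 ^- m <= `|b| ->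
  (forall s, 0 <= s <= 1 -> `|(a + b * s) - (a' + b' * s)| <= e) ->
  (lebesgue_measure (band m a b k `\` band m a' b' k) <= (4 * e * 2 ^+ m)%:E)%E.
Proof.
move=> e0 bm close.
have m0 : 0 < 2 ^+ m :> R by rewrite exprn_gt0.
have b0 : 0 < `|b| by apply: lt_le_trans bm; rewrite invr_gt0.
have bn0 : b != 0 by rewrite -normr_gt0.
pose c (j : nat) := (j%:R / 2 ^+ m - a) / b.
pose I j := `[c j - e / `|b|, c j + e / `|b|]%classic.
have eb : e / `|b| <= e * 2 ^+ m.
  by rewrite ler_wpM2l// -[leRHS]invrK lef_pV2 ?posrE ?invr_gt0.
have muI j : (lebesgue_measure (I j) <= (2 * e * 2 ^+ m)%:E)%E.
  rewrite lebesgue_measure_itv/=; case: ifPn => _; last first.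
    by rewrite lee_fin !mulr_ge0// ltW.
  by rewrite -EFinB lee_fin; lra.
have inI j s : `|a + b * s - j%:R / 2 ^+ m| <= e -> I j s.
  move=> h; rewrite /I/= in_itv/=.
  have : `|s - c j| <= e / `|b|.
    rewrite ler_pdivlMr// -normrM.
    by rewrite (_ : _ * b = a + b * s - j%:R / 2 ^+ m)// /c; field; rewrite bn0 gt_eqF.
  by rewrite ler_distl.
apply: (@le_trans _ _ (lebesgue_measure (I k `|` I k.+1))).
  apply: le_measure; rewrite ?inE.
  - by apply: measurableD; exact: measurable_band.
  - by apply: measurableU; exact: measurable_itv.
  - move=> s [[/andP[s0 s1] /andP[ks sk]] nb].
    have /close : 0 <= s <= 1 by rewrite s0 ltW.
    rewrite ler_distlC => /andP[c1 c2].
    have ks' : k%:R / 2 ^+ m <= a + b * s by rewrite ler_pdivrMr// mulrC.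
    have sk' : a + b * s < k.+1%:R / 2 ^+ m by rewrite ltr_pdivlMr// mulrC.
    have [h|h] := ltP (a' + b' * s) (k%:R / 2 ^+ m).
      by left; apply: inI; rewrite ler_distlC; apply/andP; split; lra.
    have [h'|h'] := leP (k.+1%:R / 2 ^+ m) (a' + b' * s).
      by right; apply: inI; rewrite ler_distlC; apply/andP; split; lra.
    exfalso; apply: nb; split; first by rewrite s0.
    by rewrite mulrC -ler_pdivrMr// h/= -ltr_pdivlMr.
apply: (le_trans (measureU2 _ _ _)) => //=; try exact: measurable_itv.
rewrite (_ : 4 * e * 2 ^+ m = 2 * e * 2 ^+ m + 2 * e * 2 ^+ m); last by ring.
by rewrite EFinD leeD.
Qed.

(* For a slope below [2^-m] the coordinate leaves its initial dyadic interval
   at most once, always to the same neighbour. *)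
Definition exited m (x : nat) a b s : bool :=
  if 0 <= b then x%:R + 1 <= 2 ^+ m * (a + 2 + b * s)
  else 2 ^+ m * (a + 2 + b * s) < x%:R.

Lemma exited_mono m x a b s t : s <= t -> exited m x a b s -> exited m x a b t.
Proof.
have m0 : 0 < 2 ^+ m :> R by rewrite exprn_gt0.
rewrite /exited => st; case: (leP 0 b) => b0 h.
  by apply: (le_trans h); rewrite ler_pM2l// lerD2l ler_wpM2l.
by apply: le_lt_trans h; rewrite ler_pM2l// lerD2l ler_wnM2l// ltW.
Qed.

(** Adding 2 makes the value at time 0 non-negative, as truncation requires, and shifts the dyadic
    grid by the whole number [2^(m+1)] of cells. *)
Lemma small_slope_position m a b s (x := Num.truncn (2 ^+ m * (a + 2))) :
  -2 <= a -> `|b| < 2 ^- m -> 0 <= s < 1 ->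
  let i := (x%:Z + (if exited m x a b s then (if 0 <= b then 1 else -1) else 0))%R in
  i%:~R <= 2 ^+ m * (a + 2 + b * s) < i%:~R + 1.
Proof.
move=> a2 bm /andP[s0 s1].
have m0 : 0 < 2 ^+ m :> R by rewrite exprn_gt0.
have /andP[x1 x2] : x%:R <= 2 ^+ m * (a + 2) < x.+1%:R.
  by apply: truncn_itv; rewrite pmulr_rge0//; lra.
rewrite -(natr1 x) in x2.
have bs : `|2 ^+ m * (b * s)| < 1.
  rewrite normrM (gtr0_norm m0) mulrC -ltr_pdivlMr// mul1r.
  apply: le_lt_trans bm; rewrite normrM (ger0_norm s0).
  by rewrite ler_piMr// ltW.
move: bs; rewrite ltr_norml => /andP[bs1 bs2] /=.
rewrite /exited mulrDr; set y := 2 ^+ m * (a + 2) in x1 x2 *.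
set z := 2 ^+ m * (b * s) in bs1 bs2 *.
case: (leP 0 b) => b0.
  have z0 : 0 <= z by rewrite !mulr_ge0// ltW.
  case: ifPn => h; rewrite intrD/= ?mulr1z ?mulr0z -?pmulrn; rewrite -?ltNge -?leNgt in h; apply/andP; split; lra.
have z0 : z <= 0 by rewrite pmulr_rle0// mulr_le0_ge0// ltW.
case: ifPn => h; rewrite intrD/= ?mulrN1z ?mulr0z -?pmulrn; rewrite -?ltNge -?leNgt in h; apply/andP; split; lra.
Qed.

(** For small slopes the exit time is not stable under perturbation of the coefficients, so it is
    itself recorded, on a grid of step [2^-r]. [find] returns [2 ^ r], that is time 1, when no grid
    time has exited. *)
Definition exit_sample r m a b : nat :=
  find (fun j : nat => exited m (Num.truncn (2 ^+ m * (a + 2))) a b (j%:R / 2 ^+ r))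
    (iota 0 (2 ^ r)).

Lemma exit_sampleP r m a b s (x := Num.truncn (2 ^+ m * (a + 2)))
    (t := exit_sample r m a b) : 0 <= s < 1 ->
  if exited m x a b s then (t%:R - 1) / 2 ^+ r < s else s < t%:R / 2 ^+ r.
Proof.
move=> /andP[s0 s1].
have r0 : 0 < 2 ^+ r :> R by rewrite exprn_gt0.
have rE : (2 ^ r)%:R = 2 ^+ r :> R by rewrite natrX.
have tr : (t <= 2 ^ r)%N by rewrite -[leqRHS](size_iota 0) find_size.
case: ifPn => h.
  have [t0|t0] := posnP t.
    rewrite t0 sub0r; apply: lt_le_trans s0.
    by rewrite pmulr_llt0 ?invr_gt0// ltrN10.
  rewrite ltNge; apply/negP => st.
  have := @before_find _ 0%N
    (fun j : nat => exited m x a b (j%:R / 2 ^+ r)) (iota 0 (2 ^ r)) t.-1.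
  rewrite -/(exit_sample r m a b) -/t nth_iota ?add0n; last by lia.
  rewrite (exited_mono _ h); last by rewrite -subn1 natrB.
  by move=> /(_ ltac:(lia)).
have [tlt|] := ltnP t (2 ^ r); last first.
  move=> h'; have -> : t = (2 ^ r)%N by apply/eqP; rewrite eqn_leq tr.
  by rewrite rE divff// gt_eqF.
rewrite ltNge; apply: contra h => ts; apply: exited_mono ts _.
have := @nth_find _ 0%N
  (fun j : nat => exited m x a b (j%:R / 2 ^+ r)) (iota 0 (2 ^ r)).
rewrite -/(exit_sample r m a b) -/t nth_iota//; apply.
by rewrite has_find size_iota.
Qed.

(** Both coordinates go through the same cells in the same order, and can disagree only strictly
    between the grid times of index [t - 1] and [t], where [t] is the common exit sample. *)
Lemma small_slope_band m r a b a' b' k :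
  -2 <= a -> -2 <= a' -> `|b| < 2 ^- m -> `|b'| < 2 ^- m ->
  (0 <= b) = (0 <= b') ->
  Num.truncn (2 ^+ m * (a + 2)) = Num.truncn (2 ^+ m * (a' + 2)) ->
  exit_sample r m a b = exit_sample r m a' b' ->
  (lebesgue_measure (band m a b k `\` band m a' b' k) <= (2 ^- r)%:E)%E.
Proof.
move=> a2 a2' bm bm' sg xE tE.
have r0 : 0 < 2 ^+ r :> R by rewrite exprn_gt0.
set t := exit_sample r m a b in tE.
pose I : set R := `](t%:R - 1) / 2 ^+ r, t%:R / 2 ^+ r[%classic.
have : (lebesgue_measure I <= (2 ^- r)%:E)%E.
  rewrite lebesgue_measure_itv/=; case: ifPn => _; last first.
    by rewrite lee_fin invr_ge0 ltW.
  by rewrite -EFinB lee_fin; lra.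
apply: le_trans; apply: le_measure; rewrite ?inE.
- by apply: measurableD; exact: measurable_band.
- exact: measurable_itv.
move=> s [[s01 /andP[ks sk]] nb].
have := @exit_sampleP r m a b s s01; have := @exit_sampleP r m a' b' s s01.
have := @small_slope_position m a' b' s a2' bm' s01.
have := @small_slope_position m a b s a2 bm s01.
rewrite /= -xE -sg -tE -/t.
have same (i : int) : i%:~R <= 2 ^+ m * (a + 2 + b * s) < i%:~R + 1 ->
    i%:~R <= 2 ^+ m * (a' + 2 + b' * s) < i%:~R + 1 -> False.
  move=> h1 /andP[h2 h3]; apply: nb; split=> //.
  have sh (u v : R) : 2 ^+ m * (u + 2 + v * s) = 2 ^+ m * (u + v * s) + 2 ^+ m.+1.
    by rewrite exprS; ring.
  have iE : i = k%:Z + 2 ^+ m.+1.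
    apply: int_itv_uniq h1 _; rewrite sh intrD rmorphXn/= -pmulrn.
    by rewrite -(natr1 k) in sk; apply/andP; split; lra.
  move: h2 h3; rewrite iE sh intrD rmorphXn/= -pmulrn => h2 h3.
  by rewrite -(natr1 k); apply/andP; split; lra.
case: (exited m _ a b s); case: (exited m _ a' b' s) => h1 h2 h3 h4.
- by case: (same _ h1 h2).
- by rewrite /I/= in_itv/= h4 h3.
- by rewrite /I/= in_itv/= h3 h4.
- by case: (same _ h1 h2).
Qed.

Lemma truncn_le_natr (x : R) n : x <= n%:R -> (Num.truncn x < n.+1)%N.
Proof.
by move=> xn; rewrite ltnS truncn_le_nat -natr1; lra.
Qed.

(** The classes of equal code play the role of a finite net. Steep coordinates record both
    coefficients, flat ones their initial cell and exit sample. *)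
Lemma band_code m r (N := (2 ^ (m + r + 5))%N) :
  exists code : R -> R -> bool * bool * 'I_N.+1 * 'I_N.+1,
  forall a b a' b' : R, `|a| <= 2 -> `|a'| <= 2 -> `|b| <= 1 -> `|b'| <= 1 ->
  code a b = code a' b' -> forall k,
  (lebesgue_measure (band m a b k `\` band m a' b' k) <= (2 ^- r)%:E)%E.
Proof.
(* Coefficients known up to [1 / D] give values up to [e = 2 / D] on [[0, 1]], and the loss
   [4 * e * 2^m] for steep coordinates is then exactly [2^-r]. The shifted coefficients times [D]
   are at most [4 * D = N]. *)
pose D : R := 2 ^+ (m + r + 3).
have D0 : 0 < D by rewrite exprn_gt0.
have NE : N%:R = 4 * D by rewrite natrX /D !exprD; ring.
have m0 : 0 < 2 ^+ m :> R by rewrite exprn_gt0.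
have r0 : 0 < 2 ^+ r :> R by rewrite exprn_gt0.
pose big (b : R) := 2 ^- m <= `|b|.
exists (fun a b => (big b, 0 <= b,
  if big b then inord (Num.truncn ((a + 2) * D))
  else inord (Num.truncn (2 ^+ m * (a + 2))),
  if big b then inord (Num.truncn ((b + 1) * D)) else inord (exit_sample r m a b))).
move=> a b a' b'.
rewrite !ler_norml => /andP[a1 a2] /andP[a1' a2'] /andP[b1 b2] /andP[b1' b2'].
move=> [] hb hs; rewrite -hb; case: ifPn => bb.
  move=> hx hy k.
  have inN (u : R) : u <= 4 -> (Num.truncn (u * D) < N.+1)%N.
    by move=> u4; apply: truncn_le_natr; rewrite NE ler_pM2r.
  have {}hx : Num.truncn ((a + 2) * D) = Num.truncn ((a' + 2) * D).
    by move/(congr1 val): hx; rewrite /= !inordK//; apply: inN; lra.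
  have {}hy : Num.truncn ((b + 1) * D) = Num.truncn ((b' + 1) * D).
    by move/(congr1 val): hy; rewrite /= !inordK//; apply: inN; lra.
  have dist (u v w : R) : -w <= u -> -w <= v ->
      Num.truncn ((u + w) * D) = Num.truncn ((v + w) * D) -> `|u - v| <= D^-1.
    move=> uw vw /truncn_eq_dist; rewrite !pmulr_lge0// => h.
    rewrite -(ler_pM2r D0) mulVf ?gt_eqF// -{1}(gtr0_norm D0) -normrM.
    rewrite (_ : (u - v) * D = (u + w) * D - (v + w) * D); last by ring.
    by apply: h; lra.
  have da := dist _ _ _ a1 a1' hx.
  have db := dist _ _ _ b1 b1' hy.
  have -> : 2 ^- r = 4 * (2 * D^-1) * 2 ^+ m.
    by rewrite /D !exprD; field; rewrite !gt_eqF.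
  apply: big_slope_band => //; first by rewrite mulr_ge0// invr_ge0 ltW.
  move=> s /andP[s0 s1].
  rewrite (_ : _ - _ = (a - a') + (b - b') * s); last by ring.
  apply: (le_trans (ler_normD _ _)); rewrite normrM (ger0_norm s0).
  have : `|b - b'| * s <= D^-1.
    by apply: le_trans db; rewrite ler_piMr.
  lra.
move=> hx hy k.
have bb' : ~~ big b' by rewrite -hb.
have {}hx : Num.truncn (2 ^+ m * (a + 2)) = Num.truncn (2 ^+ m * (a' + 2)).
  have inN (u : R) : u <= 4 -> (Num.truncn (2 ^+ m * u) < N.+1)%N.
    move=> u4; apply: truncn_le_natr; rewrite NE mulrC.
    apply: (@le_trans _ _ (4 * 2 ^+ m)); first by rewrite ler_pM2r.
    apply: ler_wpM2l => //; apply: ler_weXn2l; first exact: ler1n.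
    by rewrite -addnA leq_addr.
  by move/(congr1 val): hx; rewrite /= !inordK//; apply: inN; lra.
have {}hy : exit_sample r m a b = exit_sample r m a' b'.
  have inN (u v : R) : (exit_sample r m u v < N.+1)%N.
    rewrite ltnS; apply: (@leq_trans (2 ^ r)%N); last first.
      by rewrite leq_pexp2l// addnAC leq_addl.
    by rewrite -[leqRHS](size_iota 0) find_size.
  by move/(congr1 val): hy; rewrite /= !inordK.
by apply: small_slope_band; rewrite // ltNge.
Qed.
End Bands.

(** * Lines and dyadic cubes *)

Section Lines.
Variables (R : realType) (d : nat).
Implicit Types (n m r : nat) (a b : 'I_d -> R).

(* The cube of index [k] at level [n] is [prod_i [k_i 2^-n, (k_i+1) 2^-n]]. *)
Definition idx := {ffun 'I_d -> nat}.
Definition bits := {ffun 'I_d -> bool}.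
Implicit Types (k : idx) (e : bits).

Definition child k e : idx := [ffun i => (k i).*2 + e i]%N.
Definition parent k : idx := [ffun i => (k i)./2].

Lemma childK k e : parent (child k e) = k.
Proof. by apply/ffunP => i; rewrite !ffunE addnC half_bit_double. Qed.

Lemma child_inj k e e' : child k e = child k e' -> e = e'.
Proof.
move=> /ffunP h; apply/ffunP => i; have := h i; rewrite !ffunE.
by move/addnI; case: (e i); case: (e' i).
Qed.

Lemma card_bits : #|{: bits}| = (2 ^ d)%N.
Proof. by rewrite card_ffun card_bool card_ord. Qed.

Lemma fsbig_finType (I : finType) (F : I -> \bar R) :
  (\sum_(i \in [set: I]) F i = \sum_i F i)%E.
Proof.
rewrite [RHS]fsbig_seq ?index_enum_uniq//.
by apply: eq_fsbigl; apply/seteqP; split => i //= _; rewrite mem_index_enum.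
Qed.

(* Lines are graphs [s |-> a + s b] over a coordinate in which their direction
   is largest. *)
Definition sloped a b : Prop :=
  (exists j, a j = 0 /\ b j = 1) /\ (forall i, `|b i| <= 1).

Definition line_time n a b k : set R :=
  [set s | forall i, band n (a i) (b i) (k i) s].

Definition occ n a b k : R := fine (lebesgue_measure (line_time n a b k)).

Lemma measurable_line_time n a b k : measurable (line_time n a b k).
Proof.
apply: is_interval_measurable => s u hs hu t stu i.
exact: band_convex (hs i) (hu i) stu.
Qed.

Lemma line_time_measure_le n a b k : sloped a b ->
  (lebesgue_measure (line_time n a b k) <= (2 ^- n)%:E)%E.
Proof.
move=> [[j [aj bj]] _].
have n0 : 0 < 2 ^+ n :> R by rewrite exprn_gt0.
pose I : set R := `[(k j)%:R / 2 ^+ n, (k j).+1%:R / 2 ^+ n]%classic.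
apply: (@le_trans _ _ (lebesgue_measure I)).
  apply: le_measure; rewrite ?inE.
  - exact: measurable_line_time.
  - exact: measurable_itv.
  - move=> s /(_ j) [_]; rewrite aj bj add0r mul1r mulrC => /andP[h1 h2].
    by rewrite /I/= in_itv/= ler_pdivrMr// h1/= ler_pdivlMr// ltW.
rewrite lebesgue_measure_itv/=; case: ifPn => _; last first.
  by rewrite lee_fin invr_ge0 ltW.
by rewrite -EFinB lee_fin -natr1; lra.
Qed.

Lemma occE n a b k : sloped a b ->
  lebesgue_measure (line_time n a b k) = (occ n a b k)%:E.
Proof.
move=> sl; rewrite /occ fineK// ge0_fin_numE//.
by apply: (le_lt_trans (line_time_measure_le _ _ sl)); rewrite ltry.
Qed.

Lemma occ_ge0 n a b k : 0 <= occ n a b k.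
Proof. exact: fine_ge0. Qed.

Lemma occ_le n a b k : sloped a b -> occ n a b k <= 2 ^- n.
Proof. by move=> sl; rewrite -lee_fin -occE// line_time_measure_le. Qed.

Lemma band_child n (u v : R) (k : nat) (e : bool) s :
  band n.+1 u v (k.*2 + e) s -> band n u v k s.
Proof.
move=> [s01 /andP[h1 h2]]; split=> //.
move: h1 h2; rewrite exprS -natr1 natrD -mul2n natrM -natr1.
by case: e => /= h1 h2; apply/andP; split; lra.
Qed.

Lemma band_has_child n (u v : R) (k : nat) s : band n u v k s ->
  exists e : bool, band n.+1 u v (k.*2 + e) s.
Proof.
move=> [s01 /andP[h1 h2]]; rewrite -natr1 in h2.
have E : 2 ^+ n.+1 * (u + v * s) = 2 * (2 ^+ n * (u + v * s)).
  by rewrite exprS mulrA.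
have [h|h] := leP (2 * k%:R + 1) (2 ^+ n.+1 * (u + v * s)); [exists true|exists false];
  split=> //; move: h; rewrite E -[(_ + _).+1%:R]natr1 natrD -mul2n natrM /= => h;
  apply/andP; split; lra.
Qed.

(** The half-open cells of the children partition that of the parent; this identity makes the line
    integral a martingale under random single children. *)
Lemma occ_children n a b k : sloped a b ->
  \sum_e occ n.+1 a b (child k e) = occ n a b k.
Proof.
move=> sl; apply/eqP; rewrite -eqe -sumEFin -occE//; apply/eqP.
under eq_bigr do rewrite -occE//.
rewrite -fsbig_finType -measure_fin_bigcup//.
- congr (lebesgue_measure _); apply/seteqP; split => s.
    by move=> [e _ /= h] i; have := h i; rewrite ffunE; exact: band_child.
  move=> h; have /choice[e he] : forall i, exists e : bool,
      band n.+1 (a i) (b i) ((k i).*2 + e) s by move=> i; exact: band_has_child.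
  by exists [ffun i => e i] => // i; rewrite !ffunE.
- exact: finite_finset.
- apply/trivIsetP => e e' _ _ ee'; apply/seteqP; split => // s [h h'] /=.
  move/eqP: ee'; apply; apply: (@child_inj k); apply/ffunP => i.
  exact: band_disjoint (h i) (h' i).
- by move=> e _; exact: measurable_line_time.
Qed.

(** Two lines of equal code differ in a cube only at times when some coordinate is in the band of
    one and not of the other. The cardinality counts [4 * (N + 1)^2 <= 16 * N^2] codes for each
    coordinate. *)
Lemma line_code m r : exists (G : finType)
  (code : ('I_d -> R) -> ('I_d -> R) -> G),
  [/\ (0 < d)%N -> (1 < #|G|)%N, (#|G| <= 2 ^ ((2 * m + 2 * r + 14) * d))%N
    & forall a b a' b', sloped a b -> sloped a' b' ->
      (forall i, `|a i| <= 2) -> (forall i, `|a' i| <= 2) ->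
      code a b = code a' b' ->
      forall k, occ m a b k <= occ m a' b' k + d%:R * 2 ^- r].
Proof.
have [code codeP] := @band_code R m r.
set N := (2 ^ (m + r + 5))%N in code codeP.
exists {ffun 'I_d -> bool * bool * 'I_N.+1 * 'I_N.+1}.
exists (fun a b => [ffun i => code (a i) (b i)]).
have cE : #|{: {ffun 'I_d -> bool * bool * 'I_N.+1 * 'I_N.+1}}|
    = ((4 * N.+1 * N.+1) ^ d)%N.
  by rewrite card_ffun !card_prod card_bool !card_ord.
split.
- by rewrite cE => d0; rewrite -(exp1n d) ltn_exp2r//; lia.
- rewrite cE expnM; have [->|d0] := posnP d; first by rewrite !expn0.
  rewrite leq_exp2r//.
  have N0 : (0 < N)%N by rewrite expn_gt0.
  have -> : (2 ^ (2 * m + 2 * r + 14) = 16 * N * N)%N.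
    by rewrite (_ : (16 = 2 ^ 4)%N)// -!expnD; congr (_ ^ _)%N; lia.
  nia.
move=> a b a' b' sl sl' ha ha' cc k.
have {}cc i : code (a i) (b i) = code (a' i) (b' i).
  by move/ffunP: cc => /(_ i); rewrite !ffunE.
rewrite -lee_fin EFinD -!occE//.
pose D i := band m (a i) (b i) (k i) `\` band m (a' i) (b' i) (k i).
have mD i : measurable (D i) by apply: measurableD; exact: measurable_band.
have mU : measurable (\bigcup_i D i) by apply: fin_bigcup_measurable.
apply: (@le_trans _ _ (lebesgue_measure (line_time m a' b' k `|` \bigcup_i D i))).
  apply: le_measure; rewrite ?inE.
  - exact: measurable_line_time.
  - by apply: measurableU => //; exact: measurable_line_time.
  - move=> s hs.
    have [h|h] := pselect (line_time m a' b' k s); [by left|right].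
    by move/existsNP: h => [i hi]; exists i => //; split.
apply: (le_trans (measureU2 _ _ _)) => //; first exact: measurable_line_time.
rewrite leeD2l//.
apply: (@le_trans _ _ (\sum_(i : 'I_d) lebesgue_measure (D i)))%E.
  by rewrite -fsbig_finType; apply: content_sub_fsum => //; [exact: finite_finset|move=> i _; exact: mD].
apply: (@le_trans _ _ (\sum_(i : 'I_d) (2 ^- r)%:E))%E.
  by apply: lee_sum => i _; apply: codeP => //; [exact: sl.2|exact: sl'.2].
by rewrite sumEFin lee_fin sumr_const card_ord mulr_natl.
Qed.

End Lines.

(** * Line integrals under refinement of a family of cubes *)

Section Refinement.
Variables (R : realType) (d : nat).
Implicit Types (n : nat) (a b : 'I_d -> R) (A : seq (idx d)) (E : idx d -> seq (bits d)).

Definition refine E A : seq (idx d) := [seq child k e | k <- A, e <- E k].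

Lemma big_refine E A (F : idx d -> R) :
  \sum_(x <- refine E A) F x = \sum_(k <- A) \sum_(e <- E k) F (child k e).
Proof. exact: big_allpairs_dep. Qed.

Lemma count_refine E A (q : nat) (G : pred (idx d)) :
  (forall k, size (E k) = q) ->
  count (fun x => G (parent x)) (refine E A) = (q * count G A)%N.
Proof.
move=> Eq; rewrite /refine; elim: A => [|k A IH] /=; first by rewrite muln0.
rewrite count_cat IH mulnDr; congr addn.
rewrite count_map (eq_count (a2 := fun=> G k)); last by move=> e /=; rewrite childK.
by case: (G k); rewrite ?count_predT ?count_pred0 ?Eq ?muln1 ?muln0.
Qed.

Lemma size_refine E A (q : nat) : (forall k, size (E k) = q) ->
  size (refine E A) = (q * size A)%N.
Proof.
by move=> Eq; rewrite -[size A]count_predT -(count_refine A predT Eq) count_predT.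
Qed.

Lemma uniq_refine E A : uniq A -> (forall k, uniq (E k)) -> uniq (refine E A).
Proof.
move=> uA uE; apply: allpairs_uniq_dep => //.
move=> [k e] [k' e'] _ _ /= h; have kk := congr1 (@parent d) h.
rewrite !childK in kk; subst k'.
by rewrite (child_inj h).
Qed.

Lemma refine_lt E A n : (forall k, k \in A -> forall i, (k i < 2 ^ n)%N) ->
  forall k, k \in refine E A -> forall i, (k i < 2 ^ n.+1)%N.
Proof.
move=> hA k /allpairsPdep[k' [e [kA _ ->]]] i.
by rewrite ffunE expnS; have := hA _ kA i; case: (e i) => /=; lia.
Qed.

(** A sloped line meeting the unit cube at a time in [[0, 1]] has a value in [[0, 1]] there and has
    moved by at most 1, so its constant terms are bounded by 2. Some bound is needed for a finite
    net. *)
Definition admissible a b := sloped a b /\ forall i, `|a i| <= 2.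

(* The integral along the line of the density, with respect to Lebesgue
   measure, of the uniform probability on the cubes of [A]. *)
Definition line_mass n A a b : R :=
  2 ^+ (d * n) / (size A)%:R * \sum_(k <- A) occ n a b k.

Lemma line_mass_all n A a b : sloped a b ->
  line_mass n.+1 (refine (fun=> enum {: bits d}) A) a b = line_mass n A a b.
Proof.
move=> sl; rewrite /line_mass (@size_refine _ _ (2 ^ d)) => [|k]; last first.
  by rewrite -cardE card_bits.
rewrite big_refine (eq_bigr (fun k => occ n a b k)); last first.
  by move=> k _; rewrite big_enum occ_children.
congr (_ * _); rewrite natrM natrX mulnS exprD.
by rewrite -mulf_div divff ?mul1r// expf_eq0 pnatr_eq0 andbF.
Qed.

(** Averaging over the child of each cube reproduces the integral at level [n], so the deviation
    bound applies to the representatives of all codes; the term [2^-n.+1] pays for passing from a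
    line to its representative. *)
Lemma line_mass_single n A (S : R) : (0 < d)%N -> uniq A -> A != [::] -> 1 <= S ->
  (forall a b, admissible a b -> line_mass n A a b <= S) ->
  exists c : idx d -> bits d, forall a b, admissible a b ->
    line_mass n.+1 (refine (fun k => [:: c k]) A) a b <=
    S * expR (2 * Num.sqrt ((d * (4 * d + 18) * n.+1)%:R *
         (2 ^+ (d * n.+1) / 2 ^+ n.+1 / (size A)%:R))) + 2 ^- n.+1.
Proof.
move=> d0 uA A0 S1 hS.
(* The error summed over all cubes is [d * 2^-r * 2^(d * m)]; this [r] turns it into
   [d / 2^d * 2^-m], at most [2^-m]. *)
set m := n.+1; set r := (d.+1 * m + d)%N.
have P0 : 0 < (size A)%:R :> R by rewrite ltr0n lt0n size_eq0.
have m0 : 0 < 2 ^+ m :> R by rewrite exprn_gt0.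
have dm0 : 0 < 2 ^+ (d * m) :> R by rewrite exprn_gt0.
have [G [code [G1 Gcard codeP]]] := @line_code R d m r.
have {}G1 := G1 d0.
(* Taking single children keeps the number of cubes, so this is already the normalization at level
   [m]. *)
pose w : R := 2 ^+ (d * m) / (size A)%:R.
have w0 : 0 < w by rewrite divr_gt0.
have /choice[rep repP] : forall g, exists l : ('I_d -> R) * ('I_d -> R),
    admissible l.1 l.2 /\
    ((exists a b, admissible a b /\ code a b = g) -> code l.1 l.2 = g).
  move=> g.
  have [[a [b [ab cg]]]|h] := pselect (exists a b, admissible a b /\ code a b = g).
    by exists (a, b).
  (* A code attained by no admissible line gets the diagonal as default. *)
  exists (fun=> 0, fun=> 1); split=> //; split; last by move=> i; rewrite normr0.
  by split; [exists (Ordinal d0)|move=> i; rewrite normr1].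
pose V g k e := w * occ m (rep g).1 (rep g).2 (child k e).
pose B : R := w / 2 ^+ m.
have B0 : 0 < B by rewrite divr_gt0.
have VB g k e : 0 <= V g k e <= B.
  rewrite mulr_ge0 ?(ltW w0) ?occ_ge0//= ler_wpM2l ?(ltW w0)//.
  by apply: occ_le; exact: (repP g).1.1.
have Vm g : \sum_(k <- A) (\sum_e V g k e) / #|{: bits d}|%:R <= S.
  apply: le_trans (hS _ _ (repP g).1); rewrite /line_mass card_bits mulr_sumr.
  apply: ler_sum => k _; rewrite -mulr_sumr occ_children; last exact: (repP g).1.1.
  rewrite /w /m mulnS exprD natrX.
  rewrite [leLHS](_ : _ = 2 ^+ (d * n) / (size A)%:R *
    occ n (rep g).1 (rep g).2 k) //.
  by field; rewrite !gt_eqF// exprn_gt0.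
have bits0 : (0 < #|{: bits d}|)%N by rewrite card_bits expn_gt0.
have [c hc] := exists_choice_le bits0 G1 uA B0 S1 VB Vm.
exists c => a b ab; set g := code a b.
have cg : code a b = code (rep g).1 (rep g).2.
  by rewrite (repP g).2//; exists a, b.
have errP : d%:R * 2 ^- r * 2 ^+ (d * m) <= 2 ^- m :> R.
  rewrite /r exprD mulSn exprD !invfM.
  have hd : d%:R / 2 ^+ d <= 1 :> R.
    by rewrite ler_pdivrMr ?exprn_gt0// mul1r -natrX ler_nat ltnW// ltn_expl.
  rewrite [leLHS](_ : _ = d%:R / 2 ^+ d * 2 ^- m); last first.
    by field; rewrite !gt_eqF// exprn_gt0.
  by rewrite ler_piMl// invr_ge0 ltW.
apply: (@le_trans _ _ (\sum_(k <- A) (V g k (c k) + w * (d%:R * 2 ^- r)))).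
  rewrite /line_mass (@size_refine _ _ 1%N)// mul1n big_refine mulr_sumr.
  apply: ler_sum => k _; rewrite big_seq1 /V -mulrDr ler_pM2l//.
  by apply: codeP => //; [exact: ab.1|exact: (repP g).1.1|exact: ab.2|
    exact: (repP g).1.2].
rewrite big_split/= big_const_seq count_predT iter_addr_0.
apply: lerD; last first.
  apply: le_trans errP; rewrite -[leLHS]mulr_natr /w.
  rewrite [leLHS](_ : _ = d%:R / 2 ^+ r * 2 ^+ (d * m))//.
  by field; rewrite !gt_eqF// exprn_gt0.
apply: (le_trans (hc g)); rewrite ler_pM2l ?(lt_le_trans ltr01)//.
rewrite ler_expR ler_pM2l// ler_sqrt; last first.
  by rewrite mulr_ge0// divr_ge0 ?ltW// divr_gt0.
rewrite mulrC (_ : _ / _ / (size A)%:R = B); last by rewrite /B /w mulrAC.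
rewrite ler_pM2r//.
set M := ((2 * m + 2 * r + 14) * d)%N in Gcard.
have G0 : 0 < #|G|%:R :> R by rewrite ltr0n (ltn_trans _ G1).
apply: (@le_trans _ _ (ln (2 ^+ M))).
  by rewrite ler_ln ?posrE ?exprn_gt0// -natrX ler_nat.
rewrite lnXn//.
have ln2 : ln 2 <= 1 :> R.
  by apply: (@le_ln1Dx R 1); lra.
apply: (@le_trans _ _ (1 *+ M)); first by rewrite lerMn2r ln2 orbT.
(* [M = d * ((2 * d + 4) * m + 2 * d + 14)], and [1 <= m] gives the factor [d * (4 * d + 18)]. *)
rewrite ler_nat /M /r; rewrite /m; nia.
Qed.
End Refinement.

(** * The tree of cubes *)

Section Tree.
Variables (R : realType) (d : nat) (u : nat -> R).
Hypotheses (d_gt0 : (0 < d)%N) (u_gt0 : forall n, 0 < u n)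
  (u_dec : forall n, u n.+1 <= u n) (u_doubling : forall n, u n <= 2 ^+ d * u n.+1).

(** [(u 0)^-1] makes the lower bound on the number of cubes true at level 0; [2^d] is what doubling
    may lose at a step with single children. *)
Let K : R := Num.max (2 ^+ d) (u 0)^-1.

(** The first factor bounds the logarithm of the net, the second the contribution of one cube, with
    [K * u n] in place of the inverse of the number of cubes. *)
Definition deviation n : R :=
  Num.sqrt ((d * (4 * d + 18) * n.+1)%:R *
    (2 ^+ (d * n.+1) / 2 ^+ n.+1 * (Num.max (2 ^+ d) (u 0)^-1 * u n))).

Definition mass_bound n : R := expR (\sum_(i < n) (2 * deviation i + 2 ^- i.+1)).

(** The alternative of a single cube covers the levels before the first branching, where [u n] may
    exceed [2^d]. Keeping the bound [2^d] free of [u 0] lets the final covering constant depend on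
    [d] only. *)
Let invariant n (A : seq (idx d)) : Prop :=
  [/\ uniq A /\ (forall k, k \in A -> forall i, (k i < 2 ^ n)%N),
      1 <= K * u n * (size A)%:R,
      (size A <= 1)%N \/ (size A)%:R * u n <= 2 ^+ d
    & forall a b, admissible a b -> line_mass n A a b <= mass_bound n].

(** All cubes have [q] children. The form with predicates can be iterated to ancestors, and yields
    both the existence of children and the equal shares of descendants. *)
Let descends (A A' : seq (idx d)) : Prop :=
  exists2 q : nat, (0 < q)%N & forall G : pred (idx d),
    count (fun k => G (parent k)) A' = (q * count G A)%N.

Let mass_bound_ge1 n : 1 <= mass_bound n.
Proof.
rewrite -expR0 ler_expR sumr_ge0// => i _.
by rewrite addr_ge0 ?mulr_ge0 ?sqrtr_ge0// invr_ge0 exprn_ge0.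
Qed.

(** Since [mass_bound n] is at least 1, an additive error [x] is at most a factor [1 + x], hence
    enters the exponent. *)
Let mass_boundS n : mass_bound n * expR (2 * deviation n) + 2 ^- n.+1 <=
  mass_bound n.+1.
Proof.
rewrite /mass_bound big_ord_recr/= !expRD mulrA.
set S := expR (\sum_(i < n) _); set x := 2 ^- n.+1.
have x0 : 0 <= x by rewrite invr_ge0 exprn_ge0.
have S1 : 1 <= S by exact: mass_bound_ge1.
have E1 : 1 <= expR (2 * deviation n).
  by rewrite -expR0 ler_expR mulr_ge0// sqrtr_ge0.
have SE : 1 <= S * expR (2 * deviation n).
  by rewrite -[leLHS]mulr1; apply: ler_pM.
apply: (@le_trans _ _ (S * expR (2 * deviation n) * (1 + x))).
  by rewrite mulrDr mulr1 lerD2l ler_peMl.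
by rewrite ler_wpM2l ?expR_ge1Dx// (le_trans _ SE).
Qed.

Let invariant_step n A : invariant n A ->
  exists2 A', invariant n.+1 A' & descends A A'.
Proof.
move=> [[uA ltA] Klo hi mA].
have K0 : 0 < K by rewrite lt_max exprn_gt0.
have K2 : 2 ^+ d <= K by rewrite le_max lexx.
have P0 : 0 < (size A)%:R :> R.
  rewrite ltr0n lt0n; apply/eqP => s0; move: Klo; rewrite s0 mulr0.
  by rewrite ler10.
have An : A != [::] by rewrite -size_eq0 -lt0n -(ltr_nat R).
(* Below the threshold, multiplying the count by [2^d] leaves [size * u] at most [2^d]; above it,
   one doubling keeps [size * u] at least [2^-d]. *)
have [full|single] := ltP ((size A)%:R * u n) 1.
  have sE (k : idx d) : size (enum {: bits d}) = (2 ^ d)%N.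
    by rewrite -cardE card_bits.
  exists (refine (fun=> enum {: bits d}) A); last first.
    by exists (2 ^ d)%N; [rewrite expn_gt0|move=> G; exact: count_refine].
  split.
  - split; first by apply: uniq_refine => // k; exact: enum_uniq.
    exact: refine_lt.
  - rewrite (size_refine _ sE) natrM natrX; apply: (le_trans Klo).
    rewrite mulrA ler_pM2r// -mulrA ler_pM2l// mulrC; exact: u_doubling.
  - right; rewrite (size_refine _ sE) natrM natrX -mulrA ler_piMr ?exprn_ge0//.
    apply: le_trans (ltW full); rewrite ler_pM2l//.
  - move=> a b ab; rewrite line_mass_all ?ab.1//; last by case: ab.
    apply: (le_trans (mA _ _ ab)); apply: le_trans (mass_boundS n).
    have E1 : 1 <= expR (2 * deviation n).
      by rewrite -expR0 ler_expR mulr_ge0// sqrtr_ge0.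
    apply: ler_wpDr; first by rewrite invr_ge0 exprn_ge0.
    by rewrite ler_peMr// (le_trans _ (mass_bound_ge1 n)).
have [c hc] := line_mass_single d_gt0 uA An (mass_bound_ge1 n) mA.
exists (refine (fun k => [:: c k]) A); last first.
  by exists 1%N => // G; exact: count_refine.
have sE := @size_refine d (fun k => [:: c k]) A 1%N (fun=> erefl).
rewrite mul1n in sE.
split.
- by split; [exact: uniq_refine|exact: refine_lt].
- rewrite sE; apply: (le_trans single).
  rewrite mulrC ler_pM2r//; apply: (le_trans (u_doubling n)).
  by rewrite ler_wpM2r// ltW.
- rewrite sE; case: hi => hi; [by left|right].
  by apply: le_trans hi; rewrite ler_pM2l.
- move=> a b ab; apply: le_trans (mass_boundS n); apply: (le_trans (hc _ _ ab)).
  rewrite lerD2r ler_wpM2l ?(le_trans _ (mass_bound_ge1 n))// ler_expR ler_wpM2l//.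
  rewrite ler_wsqrtr// ler_wpM2l// ler_wpM2l ?divr_ge0 ?exprn_ge0//.
  by rewrite -div1r ler_pdivrMr.
Qed.

Lemma exists_tree : exists A : nat -> seq (idx d),
  [/\ (forall n, uniq (A n)) /\
        (forall n k, k \in A n -> forall i, (k i < 2 ^ n)%N),
      forall n, exists2 q : nat, (0 < q)%N & forall G : pred (idx d),
        count (fun k => G (parent k)) (A n.+1) = (q * count G (A n))%N,
      forall n, 1 <= Num.max (2 ^+ d) (u 0)^-1 * u n * (size (A n))%:R,
      forall n, (size (A n) <= 1)%N \/ (size (A n))%:R * u n <= 2 ^+ d
    & forall n a b, admissible a b -> line_mass n (A n) a b <= mass_bound n].
Proof.
have /choice[f fP] : forall p : nat * seq (idx d), exists A',
    invariant p.1 p.2 -> invariant p.1.+1 A' /\ descends p.2 A'.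
  move=> [n A]; have [/invariant_step[A' ? ?]|h] := pselect (invariant n A).
    by exists A'.
  by exists [::].
pose A := fix A n := if n is n'.+1 then f (n', A n') else [:: [ffun=> 0%N] : idx d].
have inv n : invariant n (A n).
  elim: n => [|n IH]; last by have /= [] := fP (n, A n) IH.
  have K1 : 1 <= K * u 0.
    by rewrite -ler_pdivrMr// div1r le_max lexx orbT.
  split=> /=.
  - by split=> // k; rewrite inE => /eqP -> i; rewrite ffunE.
  - by rewrite mulr1.
  - by left.
  - move=> a b [sl _]; apply: le_trans (mass_bound_ge1 0).
    rewrite /line_mass muln0 expr0 /= invr1 !mul1r big_seq1.
    by have := occ_le 0 [ffun=> 0%N] sl; rewrite expr0 invr1.
exists A; split.
- by split=> n; have [[]] := inv n.
- by move=> n; have [_ ] := fP (n, A n) (inv n).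
- by move=> n; have [] := inv n.
- by move=> n; have [] := inv n.
- by move=> n; have [] := inv n.
Qed.
End Tree.

(** * From the integral condition to bounded line integrals *)

Section IntegralCondition.
Variables (R : realType) (h : R -> R).
Hypothesis h_gauge : gauge_function h.

Let integrand (d : nat) (t : R) : R :=
  t^-1 * Num.sqrt (t ^ (1 - d%:Z) * `|ln t| * h t).

Let integrandE d t : integrand d.+1 t = t^-1 * Num.sqrt (t ^- d * `|ln t| * h t).
Proof.
rewrite /integrand (_ : (1 - d.+1%:Z)%R = (- d%:Z)%R); last by lia.
by rewrite -exprnN.
Qed.

Let measurable_integrand d :
  measurable_fun (`]0, 1[%classic : set R) (EFin \o integrand d.+1).
Proof.
apply/measurable_EFinP; apply: open_continuous_measurable_fun.
  exact: interval_open.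
move=> t; rewrite inE/= in_itv/= => /andP[t0 _].
rewrite (_ : integrand d.+1 = fun t => t^-1 * Num.sqrt (t ^- d * `|ln t| * h t)).
  have [_ _ hc _] := h_gauge.
  have tn0 : t != 0 by rewrite gt_eqF.
  apply: cvgM; first exact: cvgV.
  apply: continuous_cvg; first exact: sqrt_continuous.
  apply: cvgM; last exact: hc.
  apply: cvgM; last by apply: cvg_norm; exact: continuous_ln.
  apply: cvgV; first by rewrite expf_neq0.
  exact: exprn_continuous.
by apply/funext => s; rewrite integrandE.
Qed.

Let dyadic_itv (j : nat) : set R := `[2 ^- j.+2, 2 ^- j.+1[%classic.

(** The ambient dimension is [d.+1]; each factor of the integrand is taken at the endpoint of
    [dyadic_itv j] where it is smallest. *)
Let dyadic_value (d j : nat) : R :=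
  2 ^+ j.+1 * Num.sqrt (2 ^+ (d * j.+1) * (j.+1%:R * ln 2) * h (2 ^- j.+2)).

Let ln2_gt0 : 0 < ln 2 :> R. Proof. by rewrite ln_gt0// ltr1n. Qed.

Let integrand_ge d j t : dyadic_itv j t -> dyadic_value d j <= integrand d.+1 t.
Proof.
have [h0 hmono _ _] := h_gauge.
rewrite /dyadic_itv/= in_itv/= => /andP[jt tj].
have p0 n : 0 < 2 ^- n :> R by rewrite invr_gt0 exprn_gt0.
have t0 : 0 < t by apply: lt_le_trans jt.
rewrite integrandE; apply: ler_pM.
- by rewrite exprn_ge0.
- exact: sqrtr_ge0.
- by rewrite -[leLHS]invrK lef_pV2 ?posrE// ltW.
apply: ler_wsqrtr; apply: ler_pM.
- by rewrite mulr_ge0 ?exprn_ge0// mulr_ge0// ltW.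
- by rewrite ltW// h0.
- apply: ler_pM.
  + by rewrite exprn_ge0.
  + by rewrite mulr_ge0// ltW.
  + rewrite mulnC exprM -exprVn lerXn2r ?nnegrE ?invr_ge0 ?exprn_ge0 ?(ltW t0)//.
    by rewrite -[leLHS]invrK lef_pV2 ?posrE// ltW.
  + have lnt : ln t < - (j.+1%:R * ln 2).
      rewrite mulr_natl -lnXn// -lnV ?posrE ?exprn_gt0//.
      by rewrite ltr_ln ?posrE.
    have l0 : 0 < j.+1%:R * ln 2 :> R by rewrite pmulr_lgt0// ltr0n.
    by rewrite ltr0_norm; lra.
- exact: hmono.
Qed.

Let dyadic_value_ge0 d j : 0 <= dyadic_value d j.
Proof. by rewrite mulr_ge0 ?exprn_ge0 ?sqrtr_ge0. Qed.

Let sum_dyadic_le d N :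
  ((\sum_(j < N) dyadic_value d j * 2 ^- j.+2)%:E <=
   \int[lebesgue_measure]_(t in `]0%R, 1%R[) (integrand d.+1 t)%:E)%E.
Proof.
have p0 n : 0 < 2 ^- n :> R by rewrite invr_gt0 exprn_gt0.
pose D : set R := \big[setU/set0]_(j <- iota 0 N) dyadic_itv j.
have DE : D `<=` `]0, 1[%classic.
  rewrite /D -bigcup_seq => t [j _]; rewrite /dyadic_itv/= !in_itv/= => /andP[jt tj].
  rewrite (lt_le_trans (p0 _) jt)/=; apply: (lt_trans tj).
  by rewrite invf_lt1 ?exprn_gt0// exprn_egt1// ltr1n.
have mD : measurable D by apply: bigsetU_measurable => j _; exact: measurable_itv.
have i0 t : `]0, 1[%classic t -> (0 <= (integrand d.+1 t)%:E)%E.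
  rewrite /= in_itv/= => /andP[t0 _].
  by rewrite lee_fin mulr_ge0 ?invr_ge0 ?sqrtr_ge0// ltW.
apply: (@le_trans _ _ (\int[lebesgue_measure]_(t in D) (integrand d.+1 t)%:E)%E);
  last first.
  apply: ge0_subset_integral => //; exact: measurable_integrand.
rewrite /D ge0_integral_bigsetU//=; last 4 first.
- exact: iota_uniq.
- move=> i j _ _ [t []]; rewrite /dyadic_itv/= !in_itv/= => /andP[i1 i2] /andP[j1 j2].
  have := le_lt_trans i1 j2; have := le_lt_trans j1 i2.
  rewrite !ltf_pV2 ?posrE ?exprn_gt0// !ltr_eXn2l ?ltr1n//; lia.
- exact: measurable_funS (measurable_itv _) DE (measurable_integrand d).
- by move=> t /DE; exact: i0.
rewrite -sumEFin -(big_mkord xpredT (fun j => (dyadic_value d j * 2 ^- j.+2)%:E)).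
rewrite /index_iota subn0 [leLHS]big_seq [leRHS]big_seq; apply: lee_sum => j jN.
have jE : dyadic_itv j `<=` `]0, 1[%classic.
  by apply: subset_trans DE => t jt; rewrite /D -bigcup_seq; exists j.
apply: (@le_trans _ _ (\int[lebesgue_measure]_(t in dyadic_itv j)
    (cst (dyadic_value d j)%:E) t)%E).
  rewrite integral_cst; last exact: measurable_itv.
  have muI : lebesgue_measure (dyadic_itv j) = (2 ^- j.+1 - 2 ^- j.+2)%:E.
    rewrite lebesgue_measure_itv/= lte_fin ifT ?EFinB//.
    by rewrite ltf_pV2 ?posrE ?exprn_gt0// ltr_eXn2l ?ltr1n.
  rewrite [X in (_ <= _ * X)%E]muI -EFinM lee_fin ler_wpM2l//.
  rewrite (_ : 2 ^- j.+1 = 2 * 2 ^- j.+2); last by rewrite [in RHS]exprS; field; rewrite expf_neq0.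
  lra.
apply: ge0_le_integral => //.
- exact: measurable_itv.
- by move=> t _; rewrite lee_fin.
- exact: measurable_funS (measurable_itv _) jE (measurable_integrand d).
- by move=> t jt; rewrite lee_fin; exact: integrand_ge.
- by move=> n; exact: measurable_itv.
Qed.

Lemma mass_bound_bounded d : (0 < d)%N ->
  (\int[lebesgue_measure]_(t in `]0%R, 1%R[)
     (t^-1 * Num.sqrt (t ^ (1 - d%:Z) * `|ln t| * h t))%R%:E < +oo)%E ->
  exists M, forall n, mass_bound d (fun n => h (2 ^- n)) n <= M.
Proof.
case: d => // d _ fin.
have [J hJ] : exists J, forall N, \sum_(j < N) dyadic_value d j * 2 ^- j.+2 <= J.
  move: fin (sum_dyadic_le d); rewrite /integrand.
  set I := (\int[_]_(t in _) _)%E; case: I => [J| |]//.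
    by move=> _ le; exists J => N; rewrite -lee_fin.
  by move=> _ /(_ 0%N).
have [h0 _ _ _] := h_gauge.
set u := fun n => h (2 ^- n).
have u0 n : 0 < u n by rewrite h0// invr_gt0 exprn_gt0.
pose c : R := (d.+1 * (4 * d.+1 + 18))%:R.
pose K : R := Num.max (2 ^+ d.+1) (u 0)^-1.
have K0 : 0 < K by rewrite lt_max exprn_gt0.
(* Under the root: [j.+3 <= 3 * j.+1] and [d * j.+3 = 2 * d + d * j.+1]. The outer 2 cancels
   [2^j.+1 * 2^-j.+2]. Deviations 0 and 1, which match no dyadic interval, are set aside in [a]. *)
pose C := 2 * Num.sqrt (c * 3 * 2 ^+ (2 * d) * K / ln 2).
have dev j : deviation d.+1 u j.+2 <= C * (dyadic_value d j * 2 ^- j.+2).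
  rewrite /dyadic_value (_ : C * _ = Num.sqrt (c * 3 * 2 ^+ (2 * d) * K / ln 2) *
     Num.sqrt (2 ^+ (d * j.+1) * (j.+1%:R * ln 2) * h (2 ^- j.+2))); last first.
    rewrite /C -[in 2 ^- j.+2](addn1 j.+1) exprD; field.
    by rewrite expf_neq0.
  rewrite -sqrtrM; last first.
    by rewrite !mulr_ge0 ?invr_ge0 ?exprn_ge0 ?(ltW ln2_gt0) ?(ltW K0).
  rewrite ler_wsqrtr// -/K natrM -/c.
  have -> : 2 ^+ (d.+1 * j.+3) / 2 ^+ j.+3 = 2 ^+ (2 * d) * 2 ^+ (d * j.+1) :> R.
    apply: (canLR (mulfK _)); first by rewrite expf_neq0.
    by rewrite -!exprD; congr (_ ^+ _); lia.
  have uj := u0 j.+2; rewrite -/(u j.+2).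
  rewrite [leRHS](_ : _ = c * (3 * j.+1%:R) * (2 ^+ (2 * d) * 2 ^+ (d * j.+1) *
      (K * u j.+2))); last by field; rewrite gt_eqF.
  rewrite ler_wpM2r ?mulr_ge0 ?exprn_ge0 ?(ltW K0) ?(ltW uj)//.
  by rewrite ler_wpM2l// -natrM ler_nat; lia.
pose a := deviation d.+1 u 0 + deviation d.+1 u 1.
have devS N : \sum_(i < N) deviation d.+1 u i <= a + C * J.
  have d0 i : 0 <= deviation d.+1 u i by exact: sqrtr_ge0.
  apply: (@le_trans _ _ (\sum_(i < N.+2) deviation d.+1 u i)).
    by rewrite !big_ord_recr/= -addrA lerDl addr_ge0.
  rewrite !big_ord_recl/= addrA lerD2l.
  apply: (@le_trans _ _ (C * \sum_(j < N) dyadic_value d j * 2 ^- j.+2)).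
    by rewrite mulr_sumr; apply: ler_sum => j _; exact: dev.
  by rewrite ler_wpM2l ?hJ// mulr_ge0// sqrtr_ge0.
exists (expR (2 * (a + C * J) + 1)) => n.
rewrite ler_expR big_split/= -mulr_sumr; apply: lerD; first by rewrite ler_wpM2l ?devS.
have -> : \sum_(i < n) 2 ^- i.+1 = 1 - 2 ^- n :> R.
  elim: n => [|n IH]; first by rewrite big_ord0 expr0 invr1 subrr.
  rewrite big_ord_recr/= IH exprS; field; exact: expf_neq0.
by rewrite lerBlDr lerDl invr_ge0 exprn_ge0.
Qed.
End IntegralCondition.

(** * Tubes *)

Section Tubes.
Variables (R : realType) (d : nat).
Implicit Types (n : nat) (k : idx d) (x p v : 'rV[R]_d).

Definition cube n k : set 'rV[R]_d :=
  [set x | forall i, (k i)%:R <= 2 ^+ n * x 0 i <= (k i).+1%:R].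

Lemma coord_le_enorm x i : `|x 0 i| <= enorm x.
Proof.
rewrite -sqrtr_sqr /enorm ler_wsqrtr// (bigD1 i)//= lerDl sumr_ge0// => j _.
exact: sqr_ge0.
Qed.

Lemma enorm_le x (c : R) : 0 <= c -> (forall i, `|x 0 i| <= c) -> enorm x <= d%:R * c.
Proof.
move=> c0 hx; have dc0 : 0 <= d%:R * c by rewrite mulr_ge0.
rewrite -(ger0_norm dc0) -sqrtr_sqr /enorm ler_wsqrtr//.
apply: (@le_trans _ _ (\sum_(i < d) c ^+ 2)).
  by apply: ler_sum => i _; rewrite -real_normK ?num_real// lerXn2r ?nnegrE.
rewrite sumr_const card_ord -[leLHS]mulr_natl exprMn ler_wpM2r ?sqr_ge0//.
by rewrite -natrX ler_nat; have [->|d0] := posnP d; rewrite // leq_pmulr.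
Qed.

Lemma line_slope_form p v : v != 0 -> exists (j : 'I_d) (a b : 'I_d -> R),
  [/\ a j = 0, b j = 1, forall i, `|b i| <= 1
    & forall t, exists s, forall i, p 0 i + t * v 0 i = a i + b i * s].
Proof.
move=> v0.
have [j0 hj0] : exists j, v 0 j != 0.
  apply: contrapT => /forallNP h; move/eqP: v0; apply; apply/rowP => i.
  by rewrite mxE; apply/eqP/negPn/negP/h.
pose j := [arg max_(i > j0) `|v 0 i|]%O.
have hj i : `|v 0 i| <= `|v 0 j|.
  by rewrite /j; case: arg_maxP => //= l _; apply.
have vj : v 0 j != 0.
  by rewrite -normr_gt0 (lt_le_trans _ (hj j0))// normr_gt0.
exists j, (fun i => p 0 i - p 0 j * (v 0 i / v 0 j)), (fun i => v 0 i / v 0 j).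
split.
- by rewrite divff// mulr1 subrr.
- by rewrite divff.
- by move=> i; rewrite normrM normfV ler_pdivrMr ?normr_gt0// mul1r.
- by move=> t; exists (p 0 j + t * v 0 j) => i; field.
Qed.

(* A cube meeting a tube of width at most its side is crossed, over a fixed
   proportion of its side, by one of finitely many translates of the axis. *)
Lemma tube_translates n (T : set 'rV[R]_d) (w : R) : is_tube T w -> w <= 2 ^- n ->
  exists (a : {ffun 'I_d -> 'I_33} -> 'I_d -> R) (b : 'I_d -> R),
    (forall q, sloped (a q) b) /\
    forall k, (forall i, (k i < 2 ^ n)%N) -> (exists x, cube n k x /\ T x) ->
      exists q, admissible (a q) b /\ (4 * 2 ^+ n)^-1 <= occ n (a q) b k.
Proof.
move=> [w0 [p [v [v0 ->]]]] wn.
have [j [a0 [b [a0j bj b1 line_s]]]] := line_slope_form p v0.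
set D : R := 2 ^+ n; have D0 : 0 < D by rewrite exprn_gt0.
(* In units of [1 / D], at time [z j] the axis is off the centre [z] of a hit cube by at most 3 in
   each coordinate ([yz]), so shifts by multiples of [1 / 4] from [-4] to [4] bring one translate to
   within [1 / 4]. Neither [a] nor [b] depends on the cube. *)
pose a (q : {ffun 'I_d -> 'I_33}) i : R :=
  if i == j then 0 else a0 i + ((q i)%:R - 16) / (4 * D).
have sl q : sloped (a q) b.
  by split=> //; exists j; rewrite /a eqxx.
exists a, b; split=> // k kn [x [xk [y [t _ <-]] xy]].
have [s hs] := line_s t.
pose z i : R := ((k i)%:R + 2^-1) / D.
have Dz i : D * z i = (k i)%:R + 2^-1 by rewrite /z; field; rewrite gt_eqF.
have xz i : `|D * x 0 i - D * z i| <= 2^-1.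
  by have := xk i; rewrite -/D -(natr1 (k i)) Dz ler_norml => /andP[x1 x2]; apply/andP; split; lra.
have xl i : `|D * x 0 i - D * (a0 i + b i * s)| <= 1.
  rewrite -mulrBr normrM gtr0_norm// mulrC -ler_pdivlMr// mul1r.
  apply: le_trans wn; apply: ltW; apply: le_lt_trans xy.
  by have := coord_le_enorm (x - (p + t *: v)) i; rewrite !mxE hs.
have sz : `|D * (s - z j)| <= 3 / 2.
  have := xl j; rewrite a0j bj add0r mul1r.
  rewrite (_ : D * (s - z j) = D * s - D * x 0 j + (D * x 0 j - D * z j)); last by ring.
  move=> h; apply: (le_trans (ler_normD _ _)).
  rewrite distrC in h; have := xz j; lra.
have yz i : `|D * (a0 i + b i * z j) - D * z i| <= 3.
  rewrite (_ : _ - _ = b i * (- (D * (s - z j))) + (- (D * x 0 i - D * (a0 i + b i * s)))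
    + (D * x 0 i - D * z i)); last by ring.
  apply: (le_trans (ler_normD _ _)); have h1 := xz i.
  have : `|b i * - (D * (s - z j)) - (D * x 0 i - D * (a0 i + b i * s))| <= 3 / 2 + 1.
    apply: (le_trans (ler_normD _ _)); rewrite !normrN normrM normrN.
    apply: lerD => //; apply: le_trans sz.
    by rewrite ler_piMl.
  lra.
pose Q i : R := 4 * (D * z i - D * (a0 i + b i * z j)) + 16.
have Q0 i : 0 <= Q i.
  by have := yz i; rewrite ler_norml /Q => /andP[h1 h2]; lra.
have Q33 i : (Num.truncn (Q i) < 33)%N.
  apply: truncn_le_natr.
  by have := yz i; rewrite ler_norml /Q => /andP[h1 h2]; lra.
pose q : {ffun 'I_d -> 'I_33} := [ffun i => Ordinal (Q33 i)].
(* The shift error [1 / 4] plus a drift of [1 / 8] is less than [1 / 2], so the line stays in the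
   cube for a time [1 / (4 * D)]. *)
have near_z r i : `|r - z j| <= (8 * D)^-1 ->
    `|D * (a q i + b i * r) - D * z i| <= 3 / 8.
  move=> hr; have {}hr : `|D * (r - z j)| <= 8^-1.
    rewrite normrM gtr0_norm// -ler_pdivlMl//; apply: (le_trans hr).
    by rewrite invfM mulrC.
  rewrite /a; case: eqP => [->|ij].
    by rewrite bj add0r mul1r -mulrBr; apply: (le_trans hr); lra.
  have /andP[t1 t2] := truncn_itv (Q0 i); rewrite -(natr1 (Num.truncn _)) in t2.
  rewrite ffunE /=; set c := (Num.truncn (Q i))%:R in t1 t2 *.
  rewrite (_ : D * _ - D * _ = ((c - Q i) / 4) + b i * (D * (r - z j))); last first.
    by rewrite /Q; field; rewrite gt_eqF.
  apply: (le_trans (ler_normD _ _)).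
  have : `|(c - Q i) / 4| <= 4^-1.
    by rewrite ler_norml; apply/andP; split; lra.
  have : `|b i * (D * (r - z j))| <= 8^-1.
    by rewrite normrM; apply: le_trans hr; rewrite ler_piMl.
  lra.
pose I : set R := `[z j - (8 * D)^-1, z j + (8 * D)^-1]%classic.
have knj : (k j)%:R + 1 <= D by rewrite natr1 /D -natrX ler_nat.
have k0 i : 0 <= (k i)%:R :> R by [].
have II : I `<=` line_time n (a q) b k.
  move=> r; rewrite /I/= in_itv/= => hr i.
  have hr' : `|r - z j| <= (8 * D)^-1 by rewrite ler_distl.
  split.
    have := near_z r j hr'; rewrite /a eqxx bj add0r mul1r Dz ler_norml => /andP[h1 h2].
    rewrite -(pmulr_rge0 _ D0) -(ltr_pM2l D0) mulr1.
    by have kj0 := k0 j; apply/andP; split; lra.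
  have := near_z r i hr'; rewrite Dz ler_norml -/D -(natr1 (k i)) => /andP[h1 h2].
  by apply/andP; split; lra.
have Izj : I (z j).
  by rewrite /I/= in_itv/=; apply/andP; split; rewrite ?gerBl ?lerDl invr_ge0 mulr_ge0// ltW.
exists q; split.
  split=> // i; have [/andP[z0 z1] /andP[h1 h2]] := II _ Izj i.
  have kni : (k i)%:R + 1 <= D by rewrite natr1 /D -natrX ler_nat.
  have h3 : 0 <= a q i + b i * z j by rewrite -(pmulr_rge0 _ D0) (le_trans _ h1).
  have h4 : a q i + b i * z j <= 1.
    rewrite -(ler_pM2l D0) mulr1; apply: le_trans kni.
    by rewrite -(natr1 (k i)) in h2; exact: ltW.
  have h5 : `|b i * z j| <= 1.
    by rewrite normrM (ger0_norm z0) mulr_ile1// ltW.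
  move: h5; rewrite !ler_norml => /andP[h5 h6]; apply/andP; split; lra.
rewrite -lee_fin -occE//.
have -> : ((4 * D)^-1)%:E = lebesgue_measure I.
  rewrite lebesgue_measure_itv/= lte_fin ifT; last first.
    by rewrite ltrBlDr -addrA ltrDl addr_gt0// invr_gt0 mulr_gt0.
  by rewrite -EFinB; congr (_%:E); field; rewrite gt_eqF.
apply: le_measure; rewrite ?inE => //.
- exact: measurable_itv.
- exact: measurable_line_time.
Qed.

(** Double counting: in each hit cube one of [33^d] fixed lines spends time at least
    [1 / (4 * 2^n)], while an admissible line spends at most [M * size A / 2^(d * n)] in all cubes
    of [A]. *)
Lemma tube_count n (A : seq (idx d)) (M w : R) (T : set 'rV[R]_d) (hit : pred (idx d)) :
  (forall k, k \in A -> forall i, (k i < 2 ^ n)%N) -> A != [::] -> 0 <= M ->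
  (forall a b, admissible a b -> line_mass n A a b <= M) ->
  is_tube T w -> w <= 2 ^- n ->
  (forall k, hit k -> exists x, cube n k x /\ T x) ->
  (count hit A)%:R <= (4 * 33 ^ d)%:R * M * (size A)%:R * (2 ^+ n / 2 ^+ (d * n)).
Proof.
move=> An A0 M0 hM tubeT wn hitT.
have [a [b [sl cross]]] := tube_translates tubeT wn.
have D0 m : 0 < 2 ^+ m :> R by rewrite exprn_gt0.
have P0 : 0 < (size A)%:R :> R by rewrite ltr0n lt0n size_eq0.
pose adm q := `[< admissible (a q) b >].
have step1 : (count hit A)%:R * (4 * 2 ^+ n)^-1 <=
    \sum_(k <- A) \sum_(q | adm q) occ n (a q) b k.
  rewrite -sum1_count natr_sum mulr_suml big_mkcond/= [leLHS]big_seq [leRHS]big_seq.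
  apply: ler_sum => k kA; case: ifPn => hk; last first.
    by apply: sumr_ge0 => q _; exact: occ_ge0.
  have [q [aq hq]] := cross k (An k kA) (hitT k hk).
  rewrite mul1r; apply: (le_trans hq).
  rewrite (bigD1 q)/=; last exact/asboolP.
  by rewrite lerDl sumr_ge0// => q' _; exact: occ_ge0.
have step2 : \sum_(k <- A) \sum_(q | adm q) occ n (a q) b k <=
    (33 ^ d)%:R * (M * (size A)%:R / 2 ^+ (d * n)).
  rewrite exchange_big/=.
  apply: (@le_trans _ _ (\sum_(q : {ffun 'I_d -> 'I_33}) M * (size A)%:R / 2 ^+ (d * n))).
    rewrite [leLHS]big_mkcond; apply: ler_sum => q _; case: ifPn => [/asboolP aq|_].
      by have := hM _ _ aq; rewrite /line_mass mulrC -ler_pdivlMr ?divr_gt0// invf_div mulrA.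
    by rewrite divr_ge0 ?mulr_ge0// ltW.
  by rewrite sumr_const card_ffun !card_ord mulr_natl.
have := le_trans step1 step2; rewrite ler_pdivrMr ?mulr_gt0// => h.
apply: (le_trans h); rewrite natrM.
rewrite [leLHS](_ : _ = 4 * (33 ^ d)%:R * M * (size A)%:R * (2 ^+ n / 2 ^+ (d * n)))//.
by field; rewrite gt_eqF.
Qed.
End Tubes.

(** * Hausdorff measure *)

Section Hausdorff.
Variables (R : realType) (d : nat) (h : R -> R).
Hypothesis h_gauge : gauge_function h.
Implicit Types (E F : set 'rV[R]_d) (delta : R).

Lemma gauge0_ge0 (t : R) : 0 <= gauge0 h t.
Proof.
by have [h0 _ _ _] := h_gauge; rewrite /gauge0; case: ifPn => // t0; rewrite ltW// h0.
Qed.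

Lemma hausdorff_pre_mono E delta delta' : delta <= delta' ->
  (hausdorff_pre h delta' E <= hausdorff_pre h delta E)%E.
Proof.
move=> dd; apply: le_ereal_inf => _ [F [EF dF ->]]; exists F; split=> // i.
by apply: lt_le_trans (dF i) _; rewrite lee_fin.
Qed.

Lemma hausdorff_measureE E : hausdorff_measure h E =
  ereal_sup [set hausdorff_pre h delta E | delta in `]0, 1[%classic].
Proof.
apply/cvg_lim => //.
apply: (@nonincreasing_at_right_cvge _ _ 0 (BLeft 1)); first by rewrite bnd_simp.
by move=> s t _ _ st; exact: hausdorff_pre_mono.
Qed.

Lemma hausdorff_measure_le E (c : \bar R) :
  (forall delta, 0 < delta -> (hausdorff_pre h delta E <= c)%E) ->
  (hausdorff_measure h E <= c)%E.
Proof.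
move=> hc; rewrite hausdorff_measureE; apply: ge_ereal_sup => x [t].
by rewrite /= in_itv/= => /andP[t0 _] <-; exact: hc.
Qed.

Lemma hausdorff_pre_le_measure E delta : 0 < delta ->
  (hausdorff_pre h delta E <= hausdorff_measure h E)%E.
Proof.
move=> d0; rewrite hausdorff_measureE.
pose t := Num.min delta 2^-1.
apply: (@le_trans _ _ (hausdorff_pre h t E)).
  by apply: hausdorff_pre_mono; rewrite ge_min lexx.
apply: ereal_sup_ubound; exists t => //=.
rewrite in_itv/= lt_min d0 invr_gt0 ltr0n/= gt_min.
by apply/orP; right; rewrite invf_lt1// ltr1n.
Qed.

Lemma diam_ge0 E : (0 <= diam E)%E.
Proof. by rewrite /diam le_max lexx. Qed.

Lemma diam_le E (c : R) : 0 <= c ->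
  (forall x y, E x -> E y -> enorm (x - y) <= c) -> (diam E <= c%:E)%E.
Proof.
move=> c0 hc; rewrite /diam ge_max lee_fin c0/=.
by apply: ge_ereal_sup => _ [x [y [Ex Ey ->]]]; rewrite lee_fin hc.
Qed.

Lemma enorm_le_diam E x y : (diam E < +oo)%E -> E x -> E y ->
  enorm (x - y) <= fine (diam E).
Proof.
move=> dfin Ex Ey; rewrite -lee_fin fineK; last by rewrite ge0_fin_numE// diam_ge0.
rewrite /diam le_max; apply/orP; right.
by apply: ereal_sup_ubound; exists x, y.
Qed.

Lemma diam0 : diam (set0 : set 'rV[R]_d) = 0%E.
Proof.
apply/eqP; rewrite eq_le diam_ge0 andbT.
by apply: (@diam_le _ 0).
Qed.

(** Countable covers become sequences by padding with empty sets, which cost nothing since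
    [gauge0 h 0 = 0]. *)
Lemma hausdorff_pre_le_esum (I : countType) (P : set I) (F : I -> set 'rV[R]_d) E delta :
  0 < delta -> E `<=` \bigcup_(i in P) F i ->
  (forall i, P i -> (diam (F i) < delta%:E)%E) ->
  (hausdorff_pre h delta E <= \esum_(i in P) (gauge0 h (fine (diam (F i))))%:E)%E.
Proof.
move=> delta0 EF dF.
pose F' n := if pickle_inv n is Some i then (if i \in P then F i else set0) else set0.
have FE i : P i -> F' (pickle i) = F i.
  by move=> Pi; rewrite /F' pickleK_inv mem_set.
have F0 n : ~ (pickle @` P) n -> F' n = set0.
  rewrite /F'; case E1 : (pickle_inv n) => [i|] // nP.
  case: ifPn => // /set_mem Pi; exfalso; apply: nP; exists i => //.
  by have := @pickle_invK I n; rewrite E1.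
apply: (@le_trans _ _ (\sum_(0 <= i <oo) (gauge0 h (fine (diam (F' i))))%:E)%E).
  apply: ereal_inf_lbound; exists F'; split=> // [x /EF[i Pi Fx]|n].
    by exists (pickle i) => //; rewrite FE.
  have [[i Pi <-]|/F0 ->] := pselect ((pickle @` P) n); first by rewrite FE//; exact: dF.
  by rewrite diam0 lte_fin.
rewrite nneseries_esumT; last by move=> n; rewrite lee_fin gauge0_ge0.
have -> : (\esum_(i in [set: nat]) (gauge0 h (fine (diam (F' i))))%:E =
    \esum_(i in pickle @` P) (gauge0 h (fine (diam (F' i))))%:E)%E.
  rewrite [RHS]esum_mkcond; apply: eq_esum => n _; case: ifPn => // /negP nP.
  by rewrite F0 ?diam0 /gauge0 ?ltxx// => h'; apply: nP; rewrite inE.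
rewrite (reindex_esum P (pickle @` P) pickle); last first.
  apply: (@inj_bij _ _ P pickle) => //.
  by move=> i j _ _; exact: (pcan_inj pickleK_inv).
by apply: le_esum => i Pi; rewrite FE.
Qed.

Lemma gauge_doubling_iter (t : R) m : 0 < t ->
  (forall s, 0 < s -> h (2 * s) <= 2 ^+ d * h s) ->
  h (2 ^+ m * t) <= 2 ^+ (d * m) * h t.
Proof.
move=> t0 hd; elim: m => [|m IH]; first by rewrite muln0 !expr0 !mul1r.
rewrite exprS -mulrA; apply: (le_trans (hd _ _)); first by rewrite mulr_gt0 ?exprn_gt0.
by rewrite mulnS exprD -mulrA ler_wpM2l ?exprn_ge0.
Qed.

Lemma cube_dist n (k : idx d) (x y : 'rV[R]_d) : cube n k x -> cube n k y ->
  forall i, `|(x - y) 0 i| <= 2 ^- n.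
Proof.
move=> xk yk i; have n0 : 0 < 2 ^+ n :> R by rewrite exprn_gt0.
have := xk i; have := yk i; rewrite !mxE -(natr1 (k i)) => /andP[h1 h2] /andP[h3 h4].
rewrite -(ler_pM2l n0) divff ?gt_eqF// -{1}(gtr0_norm n0) -normrM mulrBr.
by rewrite ler_norml; apply/andP; split; lra.
Qed.

Lemma diam_cube n (k : idx d) : (diam (cube n k : set 'rV[R]_d) <= (d%:R * 2 ^- n)%:E)%E.
Proof.
have p : 0 <= 2 ^- n :> R by rewrite invr_ge0 exprn_ge0.
apply: diam_le; first by rewrite mulr_ge0.
by move=> x y xk yk; apply: enorm_le => //; exact: cube_dist xk yk.
Qed.

(** The diameter is at most [d * 2^-n <= 2^d * 2^-n], and [d] doublings of [h] cost [2^(d * d)]. *)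
Lemma gauge_cube n (k : idx d) : (forall s, 0 < s -> h (2 * s) <= 2 ^+ d * h s) ->
  gauge0 h (fine (diam (cube n k : set 'rV[R]_d))) <= 2 ^+ (d * d) * h (2 ^- n).
Proof.
move=> hd; have [h0 hmono _ _] := h_gauge.
have p : 0 < 2 ^- n :> R by rewrite invr_gt0 exprn_gt0.
have le : fine (diam (cube n k : set 'rV[R]_d)) <= d%:R * 2 ^- n.
  rewrite -lee_fin fineK ?diam_cube// ge0_fin_numE ?diam_ge0//.
  by apply: (le_lt_trans (diam_cube _ _)); rewrite ltry.
rewrite /gauge0; case: ifPn => [t0|_]; last by rewrite mulr_ge0 ?exprn_ge0// ltW// h0.
apply: (le_trans (hmono _ _ t0 le)); apply: le_trans (gauge_doubling_iter d p hd).
apply: hmono; first exact: lt_le_trans le.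
by rewrite ler_pM2r// -natrX ler_nat ltnW// ltn_expl.
Qed.
End Hausdorff.

(** * The limit set *)

Section LimitSet.
Variables (R : realType) (d : nat) (A : nat -> seq (idx d)).
Hypotheses (A_uniq : forall n, uniq (A n))
  (A_lt : forall n k, k \in A n -> forall i, (k i < 2 ^ n)%N)
  (A_neq0 : forall n, A n != [::])
  (A_count : forall n, exists2 q : nat, (0 < q)%N & forall G : pred (idx d),
    count (fun k => G (parent k)) (A n.+1) = (q * count G (A n))%N).

Definition limit_set : set 'rV[R]_d :=
  [set x | forall n, exists2 k, k \in A n & cube n k x].

Let anc m (k : idx d) : idx d := iter m (@parent d) k.

Let count_anc n m : exists2 q : nat, (0 < q)%N & forall G : pred (idx d),
  count (fun k => G (anc m k)) (A (m + n)) = (q * count G (A n))%N.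
Proof.
elim: m => [|m [q q0 IH]]; first by exists 1%N => // G; rewrite mul1n.
have [q' q'0 h] := A_count (m + n).
exists (q' * q)%N => [|G]; first by rewrite muln_gt0 q'0.
rewrite -mulnA -IH -h addSn; apply: eq_count => k.
by rewrite /anc iterSr.
Qed.

(** Compatibility of the uniform distributions on two levels, written without division. *)
Let count_anc_size n m (G : pred (idx d)) :
  (count (fun k => G (anc m k)) (A (m + n)) * size (A n) =
   count G (A n) * size (A (m + n)))%N.
Proof.
have [q _ h] := count_anc n m; rewrite h.
have := h predT; rewrite !count_predT => ->.
by rewrite mulnAC mulnC.
Qed.

Let anc_in n m k : k \in A (m + n) -> anc m k \in A n.
Proof.
move=> kA; apply/negPn/negP => nk.
have [q _ /(_ (fun k => k \notin A n))] := count_anc n m.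
rewrite (_ : count _ (A n) = 0%N) ?muln0; last first.
  by apply/eqP; rewrite -leqn0 leqNgt -has_count; apply/hasPn => l lA; rewrite negbK.
by move/eqP; rewrite -leqn0 leqNgt -has_count => /hasPn/(_ _ kA); rewrite nk.
Qed.

Let child_in n k : k \in A n -> exists2 k', k' \in A n.+1 & parent k' = k.
Proof.
move=> kA; have [q q0 /(_ (pred1 k)) h] := A_count n.
have : has (fun k' => pred1 k (parent k')) (A n.+1).
  by rewrite has_count h muln_gt0 q0 -has_count has_pred1.
by move=> /hasP[k' k'A /eqP]; exists k'.
Qed.

Lemma cube_parent n (k : idx d) : cube n.+1 k `<=` (cube n (parent k) : set 'rV[R]_d).
Proof.
move=> x xk i; have := xk i; rewrite ffunE exprS.
rewrite -[in X in X -> _](odd_double_half (k i)) -mul2n.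
set p := (k i)./2; rewrite -!natr1 natrD natrM -mulrA.
by case: (odd (k i)) => /= /andP[h1 h2]; apply/andP; split; lra.
Qed.

Let cube_anc n m (k : idx d) : cube (m + n) k `<=` (cube n (anc m k) : set 'rV[R]_d).
Proof.
elim: m k => [|m IH] k x; first by rewrite add0n.
rewrite addSn /anc iterSr => xk.
exact/IH/cube_parent.
Qed.

(** Every cube has a child, so a nested sequence starts at [k]; the coordinatewise supremum of its
    lower corners lies in all of its cubes. *)
Lemma limit_set_cube n k : k \in A n -> exists2 x, limit_set x & cube n k x.
Proof.
move=> kA; have /choice[next nextP] : forall p : nat * idx d, exists k',
    p.2 \in A p.1 -> k' \in A p.1.+1 /\ parent k' = p.2.
  move=> [m l]; have [/child_in[k' ? ?]|] := boolP (l \in A m); first by exists k'.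
  by exists l.
pose c := fix c m := if m is m'.+1 then next ((m' + n)%N, c m') else k.
have cA m : c m \in A (m + n)%N.
  by elim: m => [//|m IH]; have [] := nextP ((m + n)%N, c m) IH.
have cp m : parent (c m.+1) = c m by have [] := nextP ((m + n)%N, c m) (cA m).
have ca m m' : anc m (c (m + m')%N) = c m'.
  by elim: m => [//|m IH]; rewrite /anc iterSr addSn cp.
pose lo m i : R := (c m i)%:R / 2 ^+ (m + n).
pose hi m i : R := (c m i).+1%:R / 2 ^+ (m + n).
have D0 m : 0 < 2 ^+ m :> R by rewrite exprn_gt0.
have corner m m' i : (m' <= m)%N -> lo m' i <= lo m i <= hi m' i.
  move=> m'm; pose x : 'rV[R]_d := \row_j lo m j.
  have xc : cube (m + n) (c m) x.
    by move=> j; rewrite mxE mulrC divfK ?gt_eqF// lexx ler_nat leqnSn.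
  have : cube (m' + n) (c m') x.
    rewrite -(ca (m - m')%N m') subnK//; apply: cube_anc.
    by rewrite addnA subnK.
  move=> /(_ i); rewrite mxE => /andP[h1 h2]; apply/andP; split.
    by rewrite {1}/lo ler_pdivrMr// mulrC.
  by rewrite /hi ler_pdivlMr// mulrC.
have lohi m m' i : lo m i <= hi m' i.
  have [mm|mm] := leqP m' m; first by have /andP[_ ] := corner _ _ i mm.
  have /andP[h _] := corner _ _ i (ltnW mm).
  by apply: (le_trans h); rewrite ler_pM2r ?invr_gt0// ler_nat.
pose x : 'rV[R]_d := \row_i sup (range (lo ^~ i)).
have xc m : cube (m + n) (c m) x.
  move=> i; rewrite mxE mulrC; apply/andP; split.
    rewrite -ler_pdivrMr//; apply: ub_le_sup; last by exists m.
    by exists (hi 0%N i) => _ [m' _ <-]; exact: lohi.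
  rewrite -ler_pdivlMr//; apply: ge_sup; first by exists (lo 0%N i), 0%N.
  by move=> _ [m' _ <-]; exact: lohi.
exists x; last exact: (xc 0%N).
move=> N; have [nN|Nn] := leqP n N.
  exists (c (N - n)%N); first by rewrite -[X in A X](subnK nN).
  by rewrite -[X in cube X](subnK nN).
exists (anc (n - N) k).
  by apply: anc_in; rewrite subnK// ltnW.
by apply: cube_anc; rewrite subnK ?(ltnW Nn)//; exact: (xc 0%N).
Qed.

Lemma compact_limit_set : compact limit_set.
Proof.
have cubeE n (k : idx d) : cube n k = \bigcap_i
    [set x : 'rV[R]_d | `[(k i)%:R / 2 ^+ n, (k i).+1%:R / 2 ^+ n]%classic (x 0 i)].
  have n0 : 0 < 2 ^+ n :> R by rewrite exprn_gt0.
  have E (y : R) (m m' : nat) : `[m%:R / 2 ^+ n, m'%:R / 2 ^+ n]%classic y <->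
      m%:R <= 2 ^+ n * y <= m'%:R.
    by rewrite /= in_itv/= ler_pdivrMr// ler_pdivlMr// mulrC.
  apply/seteqP; split=> x hx i; first by move=> _; apply/E; exact: hx.
  by apply/E; exact: (hx i I).
have closed_cube n (k : idx d) : closed (cube n k : set 'rV[R]_d).
  rewrite cubeE; apply: closed_bigI => i _.
  apply: (@preimage_closed _ _ (fun x : 'rV[R]_d => x 0 i)).
    by move=> x _; exact: coord_continuous.
  exact: itv_closed.
apply: (@subclosed_compact _ _ [set x : 'rV[R]_d | forall i, `[0, 1]%classic (x 0 i)]).
- rewrite (_ : limit_set = \bigcap_n \bigcup_(k in [set` A n]) cube n k).
    apply: closed_bigI => n _; apply: closed_bigcup => //; exact: finite_seq.
  apply/seteqP; split=> x h n; first by move=> _; have [k] := h n; exists k.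
  by have [k] := h n I; exists k.
- apply: (@rV_compact _ _ (fun=> `[(0 : R), 1]%classic)) => _.
  exact: segment_compact.
- move=> x /(_ 0%N)[k kA xk] i; rewrite /= in_itv/=.
  have := xk i; rewrite expr0 mul1r; have := A_lt kA i.
  by rewrite expn0 ltnS leqn0 => /eqP ->.
Qed.

Lemma size_le_sum_count (T : eqType) (s : seq T) (M : nat) (P : nat -> pred T) :
  (forall x, x \in s -> exists2 i, (i < M)%N & P i x) ->
  (size s <= \sum_(i < M) count (P i) s)%N.
Proof.
move=> sP; rewrite -sum1_size.
under [leqRHS]eq_bigr do rewrite -sum1_count big_mkcond.
rewrite exchange_big/= [leqLHS]big_seq [leqRHS]big_seq; apply: leq_sum => x /sP[i iM Pix].
by rewrite (bigD1 (Ordinal iM))//= Pix.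
Qed.

(* Both a set of diameter at most [2^-n] and its open [2^-n]-neighbourhood meet
   boundedly many cubes of level [n]. *)
Lemma count_cubes_near n (F : set 'rV[R]_d) (hit : pred (idx d)) :
  (diam F <= (2 ^- n)%:E)%E ->
  (forall k, hit k -> exists x y : 'rV[R]_d,
     [/\ cube n k x, F y & forall i, `|x 0 i - y 0 i| <= 2 ^- n]) ->
  (count hit (A n) <= 6 ^ d)%N.
Proof.
move=> dF hitF; set D : R := 2 ^+ n; have D0 : 0 < D by rewrite exprn_gt0.
have [[y0 Fy0]|F0] := pselect (F !=set0); last first.
  rewrite (_ : count _ _ = 0%N)//; apply/eqP; rewrite -leqn0 leqNgt -has_count.
  apply/hasPn => k _; apply/negP => /hitF[x [y [_ Fy _]]].
  by apply: F0; exists y.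
pose Y i := D * y0 0 i.
(* The displacements from the corner to [x], from [x] to [y] and from [y] to [y0] are at most one
   side each, which leaves 6 possible integers [k i]. *)
have near_k k i : hit k -> -3 <= (k i)%:R - Y i <= 2.
  move=> /hitF[x [y [xk Fy xy]]].
  have := xk i; rewrite -/D -(natr1 (k i)) => /andP[h1 h2].
  have sc (z z' : R) : `|z - z'| <= 2 ^- n -> - 1 <= D * z - D * z' <= 1.
    move=> h; rewrite -ler_norml -mulrBr normrM gtr0_norm//.
    by rewrite mulrC -ler_pdivlMr// mul1r.
  have /sc/andP[h3 h4] := xy i.
  have dfin : (diam F < +oo)%E by apply: (le_lt_trans dF); rewrite ltry.
  have yy : `|y 0 i - y0 0 i| <= 2 ^- n.
    have := coord_le_enorm (y - y0) i; rewrite !mxE => h.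
    apply: (le_trans h); apply: (le_trans (enorm_le_diam dfin Fy Fy0)).
    by rewrite -lee_fin fineK// ge0_fin_numE// diam_ge0.
  have /sc/andP[h5 h6] := yy.
  by rewrite /Y; apply/andP; split; lra.
pose q (k : idx d) : {ffun 'I_d -> 'I_6} := [ffun i => inord (Num.truncn ((k i)%:R - Y i + 3))].
have qE k i : hit k -> nat_of_ord (q k i) = Num.truncn ((k i)%:R - Y i + 3).
  move=> /near_k h; rewrite ffunE inordK//; apply: truncn_le_natr.
  by have /andP[] := h i; lra.
rewrite (_ : count hit (A n) = size [seq q k | k <- [seq k <- A n | hit k]]);
  last by rewrite size_map size_filter.
have qi : {in [seq k <- A n | hit k] &, injective q}.
  move=> k k'; rewrite !mem_filter => /andP[hk _] /andP[hk' _] qq.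
  apply/ffunP => i; have := congr1 (fun f : {ffun 'I_d -> 'I_6} => nat_of_ord (f i)) qq.
  rewrite /= !qE// => tt.
  have /andP[a1 a2] := near_k k i hk; have /andP[b1 b2] := near_k k' i hk'.
  have /truncn_itv/andP[t1 t2] : 0 <= (k i)%:R - Y i + 3 by lra.
  have /truncn_itv/andP[t3 t4] : 0 <= (k' i)%:R - Y i + 3 by lra.
  move: t2 t4; rewrite -tt -(natr1 (Num.truncn _)) => t2 t4; rewrite -tt in t3.
  have : (k i < (k' i).+1)%N by rewrite -(ltr_nat R) -(natr1 (k' i)); lra.
  have : (k' i < (k i).+1)%N by rewrite -(ltr_nat R) -(natr1 (k i)); lra.
  by rewrite !ltnS => h1 h2; apply/eqP; rewrite eqn_leq h1 h2.
have uq : uniq [seq q k | k <- [seq k <- A n | hit k]].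
  by rewrite map_inj_in_uniq// filter_uniq.
rewrite -(card_uniqP uq); apply: (leq_trans (max_card _)).
by rewrite card_ffun !card_ord.
Qed.

(** A mass distribution argument by counting at one level [N] at least as fine as all [n i]: each
    cube of [A N] contains a point of the limit set, which lies in some [V i], and the cubes whose
    ancestor meets [V i] have a share of at most [6^d / size (A (n i))]. *)
Lemma sum_inv_size_ge1 (M : nat) (F V : nat -> set 'rV[R]_d) (n : nat -> nat) :
  (forall i, (diam (F i) <= (2 ^- n i)%:E)%E) ->
  (forall i x, V i x -> exists2 y, F i y & forall j, `|x 0 j - y 0 j| <= 2 ^- n i) ->
  limit_set `<=` \bigcup_(i < M) V i ->
  1 <= \sum_(i < M) (6 ^ d)%:R / (size (A (n i)))%:R :> R.
Proof.
move=> dF VF cov.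
pose N := (\max_(i < M) n i)%N.
have nN (i : 'I_M) : (n i <= N)%N by exact: (@leq_bigmax _ (fun i : 'I_M => n i)).
pose hit i (k : idx d) := `[< exists x, cube (n i) k x /\ V i x >].
have sz m : 0 < (size (A m))%:R :> R by rewrite ltr0n lt0n size_eq0.
have : (size (A N) <= \sum_(i < M) count (fun k => hit i (anc (N - n i) k)) (A N))%N.
  apply: (@size_le_sum_count _ _ M (fun i k => hit i (anc (N - n i) k))) => k kA.
  have [x xA xk] := limit_set_cube kA.
  have [i /= iM Vx] := cov x xA; exists i => //.
  apply/asboolP; exists x; split=> //.
  apply: cube_anc; rewrite subnK//; exact: (nN (Ordinal iM)).
rewrite -(ler_nat R) natr_sum => le.
rewrite -(ler_pM2r (sz N)) mul1r mulr_suml; apply: (le_trans le).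
apply: ler_sum => i _; rewrite mulrAC ler_pdivlMr//.
have := count_anc_size (n i) (N - n i) (hit i); rewrite subnK// => cE.
rewrite -!natrM cE ler_nat leq_mul2r; apply/orP; right.
apply: (count_cubes_near (dF i)) => k /asboolP[x [xk /VF[y Fy xy]]].
by exists x, y.
Qed.
End LimitSet.
Arguments limit_set R {d} A _.

Lemma dyadic_scale (R : realType) (t : R) : 0 < t < 1 ->
  exists n, 2 ^- n.+1 <= t < 2 ^- n.
Proof.
move=> /andP[t0 t1].
have ex : exists n, 2 ^- n.+1 <= t.
  exists (Num.truncn t^-1); rewrite -[leRHS]invrK lef_pV2 ?posrE ?exprn_gt0 ?invr_gt0//.
  have /truncn_itv/andP[_ h] : 0 <= t^-1 by rewrite invr_ge0 ltW.
  apply: (le_trans (ltW h)); rewrite -natrX ler_nat.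
  by apply: ltnW; exact: ltn_expl.
case: (ex_minnP ex) => n hn mn; exists n; rewrite hn/=.
case: n mn {hn} => [|n] mn; first by rewrite expr0 invr1.
by rewrite ltNge; apply/negP => /mn; rewrite ltnn.
Qed.

(** * Measure, coverings and tube null subsets of the limit set *)

Section HausdorffOfTree.
Variables (R : realType) (d : nat) (h : R -> R) (A : nat -> seq (idx d)).
Hypotheses (d_ge2 : (2 <= d)%N) (h_gauge : gauge_function h)
  (h_doubling : forall t, 0 < t -> h (2 * t) <= 2 ^+ d * h t)
  (A_uniq : forall n, uniq (A n))
  (A_lt : forall n k, k \in A n -> forall i, (k i < 2 ^ n)%N)
  (A_neq0 : forall n, A n != [::])
  (A_count : forall n, exists2 q : nat, (0 < q)%N & forall G : pred (idx d),
    count (fun k => G (parent k)) (A n.+1) = (q * count G (A n))%N).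

Let u n : R := h (2 ^- n).

Let p_gt0 n : 0 < 2 ^- n :> R. Proof. by rewrite invr_gt0 exprn_gt0. Qed.

Let u_gt0 n : 0 < u n. Proof. by have [h0 _ _ _] := h_gauge; rewrite /u h0. Qed.

Let size_gt0 n : 0 < (size (A n))%:R :> R.
Proof. by rewrite ltr0n lt0n size_eq0. Qed.

(** Compactness needs open sets, so each member of a cover is thickened by a dyadic length
    comparable to its diameter, which changes its cost by a constant factor. *)
Lemma hausdorff_limit_set_gt0 (K : R) : (forall n, 1 <= K * u n * (size (A n))%:R) ->
  (0 < hausdorff_measure h (limit_set R A))%E.
Proof.
move=> Klo; have [h0 hmono _ hlim] := h_gauge.
have K0 : 0 < K.
  have := lt_le_trans ltr01 (Klo 0%N).
  by rewrite pmulr_lgt0// pmulr_lgt0.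
have inv_size n : (size (A n))%:R^-1 <= K * u n.
  by rewrite -div1r ler_pdivrMr.
pose C : R := (6 ^ d)%:R * K * 2 ^+ d.
have C0 : 0 < C by rewrite !mulr_gt0 ?exprn_gt0// ltr0n expn_gt0.
suff : (((2 * C)^-1)%:E <= hausdorff_pre h 1 (limit_set R A))%E.
  move=> le; apply: (@lt_le_trans _ _ ((2 * C)^-1)%:E).
    by rewrite lte_fin invr_gt0 mulr_gt0.
  by apply: (le_trans le); exact: hausdorff_pre_le_measure.
apply: le_ereal_inf_tmp => _ [F [cov dF ->]].
pose g i := gauge0 h (fine (diam (F i))).
have g0 i : 0 <= g i by exact: gauge0_ge0.
have dfin i : (diam (F i) < +oo)%E by apply: (lt_trans (dF i)); rewrite ltry.
have dE i : diam (F i) = (fine (diam (F i)))%:E.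
  by rewrite fineK// ge0_fin_numE// diam_ge0.
(* A set of diameter 0 has gauge 0 but must be thickened too; the extra terms [2^-i.+2] allow for
   this and sum to at most [1 / 2]. *)
have /choice[n nP] : forall i, exists n, (diam (F i) <= (2 ^- n)%:E)%E /\
    (6 ^ d)%:R / (size (A n))%:R <= C * g i + 2 ^- i.+2.
  move=> i; have : 0 <= fine (diam (F i)) by rewrite fine_ge0// diam_ge0.
  have [t0 _|//|dF0 _] := ltgtP 0 (fine (diam (F i))); last first.
    pose e : R := 2 ^- i.+2 / ((6 ^ d)%:R * K).
    have K60 : 0 < (6 ^ d)%:R * K by rewrite mulr_gt0// ltr0n expn_gt0.
    have e0 : 0 < e by rewrite divr_gt0.
    move/cvgrPdist_le: hlim => /(_ e e0); rewrite near_withinE => /nbhs_ballP[r r0 hr].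
    have [|m /andP[m1 _]] := @dyadic_scale _ (Num.min 2^-1 (r / 2)).
      rewrite lt_min invr_gt0 ltr0n/= divr_gt0//= gt_min.
      by apply/orP; left; rewrite invf_lt1// ltr1n.
    have um : u m.+1 <= e.
      have hm : ball (0 : R) r (2 ^- m.+1).
        rewrite /ball/= sub0r normrN gtr0_norm//.
        apply: (le_lt_trans m1); rewrite gt_min; apply/orP; right.
        by rewrite gtr_pMr// invf_lt1// ltr1n.
      by have := hr _ hm (p_gt0 m.+1); rewrite sub0r normrN gtr0_norm// u_gt0.
    exists m.+1; split; first by rewrite dE -dF0 lee_fin ltW.
    apply: ler_wpDl; first by rewrite mulr_ge0// ltW.
    apply: (@le_trans _ _ ((6 ^ d)%:R * (K * u m.+1))); first by rewrite ler_wpM2l.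
    rewrite mulrA; apply: (@le_trans _ _ ((6 ^ d)%:R * K * e)).
      by rewrite ler_wpM2l// ltW.
    by rewrite /e mulrC divfK// gt_eqF.
  have dF1 : fine (diam (F i)) < 1 by rewrite -lte_fin -dE.
  have [|n /andP[n1 n2]] := @dyadic_scale _ (fine (diam (F i))); first by rewrite t0.
  exists n; split; first by rewrite dE lee_fin ltW.
  have : u n <= 2 ^+ d * g i.
    rewrite /g /gauge0 t0; apply: (@le_trans _ _ (2 ^+ d * h (2 ^- n.+1))).
      have := h_doubling (p_gt0 n.+1).
      by rewrite (_ : 2 * 2 ^- n.+1 = 2 ^- n)// exprS; field; rewrite expf_neq0.
    by rewrite ler_wpM2l ?exprn_ge0// hmono.
  move=> hu; apply: ler_wpDr; first by rewrite ltW.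
  rewrite /C -!mulrA ler_wpM2l//; apply: (le_trans (inv_size n)).
  by rewrite ler_wpM2l// ltW.
pose W i : set 'rV[R]_d :=
  [set x | exists2 y, F i y & forall j, `|x 0 j - y 0 j| <= 2 ^- n i].
pose V i : set 'rV[R]_d := (W i)°.
have FV i : F i `<=` V i.
  move=> y Fy; rewrite /V /interior/=.
  have : nbhs y [set x : 'rV[R]_d | forall j, `|x 0 j - y 0 j| <= 2 ^- n i].
    apply: (@filter_forall _ _
      (fun j (x : 'rV[R]_d) => `|x 0 j - y 0 j| <= 2 ^- n i) (nbhs y)) => j.
    have /cvgrPdist_le/(_ _ (p_gt0 (n i))) := @coord_continuous R 1 d 0 j y.
    by apply: filterS => x; rewrite distrC.
  by apply: filterS => x hx; exists y.
have [D _ DV] : finite_subset_cover [set: nat] V (limit_set R A).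
  have : compact (limit_set R A) by exact: compact_limit_set.
  rewrite compact_cover; apply.
    by move=> i _; exact: open_interior.
  by move=> x /cov[i _ /FV]; exists i.
pose M := (\max_(i <- finmap.enum_fset D) i)%N.+1.
have DM i : i \in finmap.enum_fset D -> (i < M)%N.
  by move=> iD; rewrite ltnS; exact: leq_bigmax_seq.
have s1 : 1 <= \sum_(i < M) (6 ^ d)%:R / (size (A (n i)))%:R :> R.
  apply: (@sum_inv_size_ge1 R d A A_uniq A_neq0 A_count M F V n).
  - by move=> i; exact: (nP i).1.
  - by move=> i x /interior_subset[y]; exists y.
  - by move=> x /DV[i /= iD Vx]; exists i => //=; exact: DM.
have geo m : \sum_(i < m) 2 ^- i.+2 = 2^-1 - 2 ^- m.+1 :> R.
  elim: m => [|m IH]; first by rewrite big_ord0 expr1 subrr.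
  rewrite big_ord_recr/= IH (_ : 2 ^- m.+1 = 2 * 2 ^- m.+2); first by lra.
  by rewrite [in RHS]exprS; field; rewrite expf_neq0.
have s2 : \sum_(i < M) 2 ^- i.+2 <= 2^-1 :> R by rewrite geo lerBlDr lerDl ltW.
have s3 : (2 * C)^-1 <= \sum_(i < M) g i.
  have : 1 <= C * (\sum_(i < M) g i) + 2^-1.
    apply: (le_trans s1); apply: le_trans (lerD (lexx _) s2).
    by rewrite mulr_sumr -big_split/=; apply: ler_sum => i _; exact: (nP i).2.
  move=> h1; rewrite -div1r ler_pdivrMr ?mulr_gt0//; lra.
apply: (@le_trans _ _ (\sum_(0 <= i < M) (g i)%:E)%E).
  by rewrite big_mkord sumEFin lee_fin.
by apply: nneseries_lim_ge => i _; rewrite lee_fin.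
Qed.

Section UpperBounds.
Variable U : R.
Hypothesis size_le : forall n, (size (A n))%:R * u n <= U.

Lemma hausdorff_limit_set_lty : (hausdorff_measure h (limit_set R A) < +oo)%E.
Proof.
apply: (@le_lt_trans _ _ (2 ^+ (d * d) * U)%:E); last by rewrite ltry.
apply: hausdorff_measure_le => // delta delta0.
have d0 : 0 < d%:R :> R by rewrite ltr0n; exact: ltnW.
pose t : R := Num.min 2^-1 (delta / d%:R / 2).
have t01 : 0 < t < 1.
  rewrite lt_min invr_gt0 ltr0n/= !divr_gt0//= gt_min.
  by apply/orP; left; rewrite invf_lt1// ltr1n.
have [n /andP[nt _]] := dyadic_scale t01.
have dn : d%:R * 2 ^- n.+1 < delta.
  rewrite mulrC -ltr_pdivlMr//; apply: (le_lt_trans nt).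
  rewrite gt_min; apply/orP; right.
  by rewrite gtr_pMr ?divr_gt0// invf_lt1// ltr1n.
apply: (le_trans (@hausdorff_pre_le_esum _ _ _ h_gauge _ [set` A n.+1]
  (fun k => cube n.+1 k) _ _ delta0 _ _)).
- by move=> x /(_ n.+1)[k kA xk]; exists k.
- by move=> k _; apply: (le_lt_trans (diam_cube R n.+1 k)); rewrite lte_fin.
rewrite esum_fset; [|exact: finite_seq|by move=> k _; rewrite lee_fin gauge0_ge0].
rewrite -fsbig_seq// sumEFin lee_fin.
apply: (@le_trans _ _ (\sum_(k <- A n.+1) 2 ^+ (d * d) * u n.+1)).
  by apply: ler_sum => k _; exact: gauge_cube.
rewrite big_const_seq count_predT iter_addr_0 -[leLHS]mulr_natr -mulrA.
by rewrite ler_wpM2l ?exprn_ge0// mulrC.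
Qed.

Lemma covered_limit_set n : (forall m, (size (A m) <= 1)%N \/
    (size (A m))%:R * u m <= 2 ^+ d) ->
  covered_by_balls (limit_set R A) (2 ^+ (d + d * d) / u n) (2 ^- n).
Proof.
move=> hi; have C0 : 0 < 2 ^+ (d + d * d) / u n by rewrite divr_gt0 ?exprn_gt0.
(* A cube of level [d + n] has diagonal at most [d * 2^-m < 2^-n], so it fits in an open ball about
   its centre; going from [u n] to [u m] costs [2^(d * d)]. *)
pose m := (d + n)%N.
pose x (i : 'I_(size (A m))) : 'rV[R]_d :=
  \row_j (((nth [ffun=> 0%N] (A m) i j)%:R + 2^-1) / 2 ^+ m).
exists (size (A m)), x; split.
  (* With at most one cube, the ceiling of a positive number suffices, however large [h] is. *)
  have [s1|s1] := hi m.
    apply: (@le_trans _ _ 1%Z); first by rewrite lez_nat.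
    by rewrite -gtz0_ge1 ceil_gt0.
  rewrite -(ler_int R); apply: le_trans (ceil_ge _).
  rewrite ler_pdivlMr// exprD.
  have un : u n <= 2 ^+ (d * d) * u m.
    have := gauge_doubling_iter d (p_gt0 m) h_doubling.
    rewrite (_ : 2 ^+ d * 2 ^- m = 2 ^- n)// /m exprD.
    by field; rewrite !expf_neq0.
  apply: (@le_trans _ _ ((size (A m))%:R * (2 ^+ (d * d) * u m))).
    by rewrite ler_wpM2l.
  by rewrite mulrCA mulrC ler_pM2r ?exprn_gt0.
move=> y /(_ m)[k kA yk].
have im : (index k (A m) < size (A m))%N by rewrite index_mem.
exists (Ordinal im) => //; rewrite /eball/=.
have D0 : 0 < 2 ^+ m :> R by rewrite exprn_gt0.
apply: (@le_lt_trans _ _ (d%:R * 2 ^- m)).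
  apply: enorm_le; first exact: ltW.
  move=> i; have := yk i; rewrite !mxE /= nth_index// -(natr1 (k i)) => /andP[h1 h2].
  rewrite -(ler_pM2l D0) divff ?gt_eqF// -{1}(gtr0_norm D0) -normrM mulrBr.
  rewrite [2 ^+ m * (_ / _)]mulrCA divff ?gt_eqF// mulr1 ler_norml.
  by apply/andP; split; lra.
rewrite /m exprD invfM mulrA gtr_pMl// ltr_pdivrMr ?exprn_gt0// mul1r -natrX ltr_nat.
exact: ltn_expl.
Qed.

Lemma tube_null_hausdorff0 (M : R) (B : set 'rV[R]_d) :
  (forall n a b, admissible a b -> line_mass n (A n) a b <= M) ->
  B `<=` limit_set R A -> tube_null B -> (hausdorff_measure h B <= 0)%E.
Proof.
move=> hM BA tn.
have d0 : 0 < d%:R :> R by rewrite ltr0n; exact: ltnW.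
have M0 : 0 <= M.
  have ab : admissible (fun _ : 'I_d => 0 : R) (fun=> 1).
    split; last by move=> i; rewrite normr0.
    by split; [exists (Ordinal (ltnW d_ge2))|move=> i; rewrite normr1].
  apply: le_trans (hM 0%N _ _ ab); rewrite /line_mass mulr_ge0 ?divr_ge0 ?exprn_ge0//.
  by apply: sumr_ge0 => k _; exact: occ_ge0.
have U0 : 0 < U by apply: lt_le_trans (size_le 0); rewrite mulr_gt0.
(* [2^(d * d)] compares the gauge of a cube with [u], [4 * 33^d * M] comes from counting cubes, [U]
   from [size * u], and [2^d.-1] from [2^-n <= 2 * w]; the final 1 makes [C] positive. *)
pose C : R := 2 ^+ (d * d) * (4 * 33 ^ d)%:R * M * U * 2 ^+ d.-1 + 1.
have C0 : 0 < C by rewrite ltr_wpDl// !mulr_ge0 ?exprn_ge0// ltW.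
apply: hausdorff_measure_le => // delta delta0.
apply/lee_addgt0Pr => eps eps0; rewrite add0e.
pose eta : R := Num.min 1 (delta / d%:R / 2).
have eta0 : 0 < eta by rewrite lt_min ltr01 !divr_gt0.
have dd : (0 < d.-1)%N by case: d d_ge2 => [|[]].
(* The first bound forces every width below [eta], hence all cubes to have diameter less than
   [delta]; the second makes the total cost at most [eps]. *)
pose dl : R := Num.min (eta ^+ d.-1 / 2) (eps / C).
have dl0 : 0 < dl by rewrite lt_min !divr_gt0// exprn_gt0.
have [J [T [w [tubes BT sumw]]]] := tn dl dl0.
have w0 j : J j -> 0 < w j by move=> /tubes[].
have wdl j : J j -> w j ^+ d.-1 <= dl.
  move=> Jj; rewrite -lee_fin; apply: le_trans sumw; apply: esum_ge.
  exists [set j]; first by split; [exact: finite_set1|move=> _ ->].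
  by rewrite fsbig_set1.
have weta j : J j -> w j < eta.
  move=> Jj; rewrite -(ltr_pXn2r dd) ?nnegrE ?ltW// ?w0//.
  apply: (le_lt_trans (wdl j Jj)); rewrite gt_min; apply/orP; left.
  by rewrite gtr_pMr ?exprn_gt0// invf_lt1// ltr1n.
have /choice[n nP] : forall j, exists n, J j -> 2 ^- n.+1 <= w j < 2 ^- n.
  move=> j; have [Jj|nJ] := pselect (J j); last by exists 0%N.
  have [|n hn] := @dyadic_scale _ (w j); last by exists n.
  by rewrite w0//= (lt_le_trans (weta j Jj))// ge_min lexx.
pose hit j (k : idx d) := `[< exists x, cube (n j) k x /\ T j x >].
pose P := J `*`` (fun j => [set` [seq k <- A (n j) | hit j k]]).
have pn j : J j -> 2 ^- n j <= 2 * w j.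
  move=> /nP/andP[nw _]; rewrite -ler_pdivrMl//; apply: le_trans nw.
  by rewrite exprS invfM.
apply: (le_trans (@hausdorff_pre_le_esum _ _ _ h_gauge _ P
  (fun p => cube (n p.1) p.2) _ _ delta0 _ _)).
- move=> x Bx; have [j Jj Tx] := BT x Bx.
  have [k kA xk] := BA x Bx (n j).
  exists (j, k) => //; split=> //=.
  by rewrite mem_filter kA andbT; apply/asboolP; exists x.
- move=> [j k] [/= Jj _]; apply: (le_lt_trans (diam_cube R (n j) k)); rewrite lte_fin.
  rewrite mulrC -ltr_pdivlMr//; apply: (le_lt_trans (pn j Jj)).
  rewrite mulrC -ltr_pdivlMr//; apply: (lt_le_trans (weta j Jj)).
  by rewrite ge_min lexx orbT.
pose cost j (k : idx d) : \bar R :=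
  (gauge0 h (fine (diam (cube (n j) k : set 'rV[R]_d))))%:E.
rewrite /P -(@esum_esum _ _ _ _ _ cost);
  last by move=> j k _ _; rewrite lee_fin gauge0_ge0.
apply: (@le_trans _ _ (\esum_(j in J) (C * w j ^+ d.-1)%:E)%E).
  apply: le_esum => j Jj.
  rewrite esum_fset; [|exact: finite_seq|by move=> k _; rewrite lee_fin gauge0_ge0].
  rewrite -fsbig_seq ?filter_uniq// sumEFin lee_fin.
  apply: (@le_trans _ _ (\sum_(k <- [seq k <- A (n j) | hit j k]) 2 ^+ (d * d) * u (n j))).
    by apply: ler_sum => k _; exact: gauge_cube.
  rewrite big_const_seq count_predT iter_addr_0 size_filter -[leLHS]mulr_natr.
  have /andP[_ /ltW wn] := nP j Jj.
  have cnt := @tube_count R d (n j) (A (n j)) M (w j) (T j) (hit j) (@A_lt (n j))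
    (A_neq0 (n j)) M0 (hM (n j)) (tubes j Jj) wn (fun k => elimT (asboolP _)).
  have w2 : 2 ^+ n j / 2 ^+ (d * n j) <= 2 ^+ d.-1 * w j ^+ d.-1.
    rewrite -exprMn (_ : _ / _ = (2 ^- n j) ^+ d.-1).
      by apply: lerXn2r; rewrite ?nnegrE ?pn// ?mulr_ge0// ltW// w0.
    rewrite exprVn -exprM -{1}(prednK (ltnW d_ge2)) mulSn exprD mulnC.
    by field; rewrite !expf_neq0.
  apply: (@le_trans _ _ (2 ^+ (d * d) * (4 * 33 ^ d)%:R * M * U *
      (2 ^+ d.-1 * w j ^+ d.-1))); last first.
    rewrite /C mulrDl mulrA lerDl mul1r exprn_ge0// ltW// w0//.
  rewrite -!mulrA ler_wpM2l ?exprn_ge0//.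
  have := ler_wpM2l (ltW (u_gt0 (n j))) cnt.
  move=> h1; apply: (le_trans h1).
  rewrite [leLHS](_ : _ = (4 * 33 ^ d)%:R * M * ((size (A (n j)))%:R * u (n j)) *
    (2 ^+ n j / 2 ^+ (d * n j))); last by ring.
  rewrite [leRHS](_ : _ = (4 * 33 ^ d)%:R * M * U * (2 ^+ d.-1 * w j ^+ d.-1));
    last by ring.
  apply: ler_pM => //.
  + by rewrite !mulr_ge0// ltW.
  + by rewrite ler_wpM2l// mulr_ge0.
apply: ge_ereal_sup => _ [X [finX XJ] <-].
rewrite fsbig_finite// sumEFin lee_fin -mulr_sumr.
apply: (@le_trans _ _ (C * dl)).
  rewrite ler_wpM2l ?(ltW C0)// -lee_fin -sumEFin -fsbig_finite//.
  by apply: le_trans sumw; apply: esum_ge; exists X.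
by rewrite mulrC -ler_pdivlMr// ge_min lexx orbT.
Qed.
End UpperBounds.
End HausdorffOfTree.

Theorem theorem1p2 (R : realType) (d : nat) (hd : (2 <= d)%N) :
  exists C : R, 0 < C /\
    forall h : R -> R,
      gauge_function h ->
      (forall t : R, 0 < t -> h (2 * t) <= 2 ^+ d * h t) ->
      (\int[lebesgue_measure]_(t in `]0%R, 1%R[)
         (t^-1 * Num.sqrt (t ^ (1 - d%:Z) * `|ln t| * h t))%R%:E < +oo)%E ->
      exists A : set 'rV[R]_d,
        [/\ compact A,
            forall n : nat, covered_by_balls A (C / h (2 ^- n)) (2 ^- n),
            (0 < hausdorff_measure h A < +oo)%E,
            forall B : set 'rV[R]_d, B `<=` A -> borel_set B ->
              (0 < hausdorff_measure h B)%E -> ~ tube_null B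
          & ~ tube_null A].
Proof.
exists (2 ^+ (d + d * d)); split; first by rewrite exprn_gt0.
move=> h h_gauge h_doubling h_int.
have [h0 hmono _ _] := h_gauge.
pose u n : R := h (2 ^- n).
have p0 n : 0 < 2 ^- n :> R by rewrite invr_gt0 exprn_gt0.
have u0 n : 0 < u n by rewrite /u h0.
have udec n : u n.+1 <= u n.
  apply: hmono => //; rewrite lef_pV2 ?posrE ?exprn_gt0//.
  by apply: ler_weXn2l; rewrite ?ler1n.
have udbl n : u n <= 2 ^+ d * u n.+1.
  have := h_doubling _ (p0 n.+1).
  by rewrite (_ : 2 * 2 ^- n.+1 = 2 ^- n)// exprS; field; rewrite expf_neq0.
have [A [[A_uniq A_lt] A_count lo hi mass]] := exists_tree (ltnW hd) u0 udec udbl.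
have A_neq0 n : A n != [::].
  by apply/eqP => An; have := lo n; rewrite An mulr0 ler10.
have [M hM] := mass_bound_bounded h_gauge (ltnW hd) h_int.
have mass_le n a b : admissible a b -> line_mass n (A n) a b <= M.
  by move=> ab; apply: (le_trans (mass n a b ab)); exact: hM.
(* This bound may depend on [h]: it serves the finiteness of the measure and the tube null subsets,
   whereas the covering number rests on [hi]. *)
have size_le n : (size (A n))%:R * u n <= Num.max (u 0%N) (2 ^+ d).
  rewrite le_max; have [s1|s1] := hi n; apply/orP; [left|by right].
  apply: (@le_trans _ _ (u n)); first by rewrite ler_piMl ?(ltW (u0 n))// lern1.
  by elim: n {s1} => // n IH; apply: le_trans (udec n) IH.
have pos : (0 < hausdorff_measure h (limit_set R A))%E.
  exact: hausdorff_limit_set_gt0 lo.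
have not_null (B : set 'rV[R]_d) : B `<=` limit_set R A ->
    (0 < hausdorff_measure h B)%E -> ~ tube_null B.
  move=> BA B0 Bnull; have := lt_le_trans B0
    (tube_null_hausdorff0 hd h_gauge h_doubling A_uniq A_lt A_neq0 size_le mass_le BA Bnull).
  by rewrite ltxx.
exists (limit_set R A); split.
- exact: compact_limit_set.
- by move=> n; exact: covered_limit_set.
- by rewrite pos; apply: hausdorff_limit_set_lty size_le.
- by move=> B BA _; exact: not_null.
- exact: not_null.
Qed.
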